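(* Let $n$ be a positive integer and $r>0$, and let $\mathfrak{B}_r$ be the open ball of radius $r$ centered at the origin of $\mathbb{R}^n$. Let $\{\Omega_k\}_{k\in\mathbb{N}}$ be bounded domains in $\mathbb{R}^n$ with $\mathscr{L}^n(\Omega_k)=\mathscr{L}^n(\mathfrak{B}_r)$, and for each $k$ let $u_k$ be a normalized $\infty$-ground state in $\Omega_k$, extended by zero outside $\Omega_k$. Suppose that $$|\lambda_{1,\infty}^D(\Omega_k)-\lambda_{1,\infty}^D(\mathfrak{B}_r)|=o(1)\quad\text{and}\quad|\lambda_{1,\infty}^N(\Omega_k)-\lambda_{1,\infty}^N(\mathfrak{B}_r)|=o(1)\quad\text{as }k\to\infty.$$ Then $$u_k\to v_\infty\quad\text{locally uniformly in }\mathfrak{B}_r,$$ where $v_\infty(x)=1-\frac{|x|}{r}$ is the normalized $\infty$-ground state in $\mathfrak{B}_r$.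
   Context: $\mathscr{L}^n$ is Lebesgue measure on $\mathbb{R}^n$; a domain is a connected open set. For a bounded domain $\Omega$, the first Dirichlet $\infty$-eigenvalue is $$\lambda_{1,\infty}^D(\Omega)=\inf\{\|\nabla u\|_{L^\infty(\Omega)}: u\in W^{1,\infty}_0(\Omega),\ \|u\|_{L^\infty(\Omega)}=1\}=\Big(\max_{x\in\Omega}\mathrm{dist}(x,\partial\Omega)\Big)^{-1},$$ i.e. the reciprocal of the radius of the largest ball inscribed in $\Omega$ (this formula may be taken as the definition). The first nontrivial Neumann $\infty$-eigenvalue is $$\lambda_{1,\infty}^N(\Omega)=\frac{2}{\mathrm{diam}(\Omega)},$$ where $\mathrm{diam}(\Omega)=\max_{x,y\in\overline\Omega}d_\Omega(x,y)$ is the intrinsic diameter and $d_\Omega(x,y)$ is the geodesic distance, the infimum of the lengths of Lipschitz curves in $\overline\Omega$ connecting $x$ and $y$ (this formula is taken as the definition). In particular $\lambda_{1,\infty}^D(\mathfrak{B}_r)=\lambda_{1,\infty}^N(\mathfrak{B}_r)=1/r$. An $\infty$-ground state in $\Omega$ is a nontrivial viscosity solution $u$ of $$\min\big\{-\Delta_\infty u,\ |\nabla u|-\lambda_{1,\infty}^D(\Omega)\,u\big\}=0\ \text{ in }\Omega,\qquad u=0\ \text{ on }\partial\Omega,$$ where $\Delta_\infty u(x)=\nabla u(x)^T D^2u(x)\,\nabla u(x)$ is the $\infty$-Laplace operator; it is normalized if $\|u\|_{L^\infty(\Omega)}=1$. It need not be unique for a general $\Omega$.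
   Formalization: Since the hypotheses are translation invariant, the literal claim fails (take Ω_k = B_r + k e₁); the convergence proved is u_k(c_k + ·) → v_∞ locally uniformly in B_r, for every choice of centres c_k of largest balls inscribed in Ω_k. *)

(* Defs.v *)
From HB Require Import structures.
From mathcomp Require Import all_boot all_order all_algebra.
From mathcomp Require Import all_classical all_reals all_analysis.

Set Implicit Arguments.
Unset Strict Implicit.
Unset Printing Implicit Defensive.

Import Order.TTheory GRing.Theory Num.Theory.
Import numFieldNormedType.Exports.

Local Open Scope classical_set_scope.
Local Open Scope ring_scope.

(* The norm [`| x |] on ['rV[R]_n] is the sup norm. It induces the usual
   topology and the usual bounded sets, but lengths, distances and gradients
   below are Euclidean. *)
Definition enorm (R : realType) (n : nat) (x : 'rV[R]_n) : R :=
  Num.sqrt (\sum_i x 0 i ^+ 2).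

Definition eball (R : realType) (n : nat) (r : R) : set 'rV[R]_n :=
  [set x | enorm x < r].

Definition bounded_domain (R : realType) (n : nat) (Om : set 'rV[R]_n) : Prop :=
  [/\ open Om, connected Om & bounded_set Om].

Definition boundary (T : topologicalType) (A : set T) : set T :=
  closure A `\` A°.

Definition box (R : realType) (n : nat) (a b : 'rV[R]_n) : set 'rV[R]_n :=
  [set x | forall i, a 0 i <= x 0 i <= b 0 i].

(* Lebesgue outer measure, by countable covers with closed boxes; it is
   Lebesgue measure on Lebesgue measurable sets, in particular on open sets. *)
Definition lebesgueRn (R : realType) (n : nat) (A : set 'rV[R]_n) : \bar R :=
  ereal_inf [set m | exists a b : nat -> 'rV[R]_n,
    [/\ forall k i, a k 0 i <= b k 0 i,
        A `<=` \bigcup_k box (a k) (b k)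
      & m = (\sum_(0 <= k <oo) (\prod_i (b k 0 i - a k 0 i))%:E)%E]].

(* The essential supremum of [`|u|] over [Om]. *)
Definition Linfty_norm (R : realType) (n : nat) (Om : set 'rV[R]_n)
    (u : 'rV[R]_n -> R) : \bar R :=
  ereal_inf [set y : \bar R |
    lebesgueRn [set x | Om x /\ (y < `|u x|%:E)%E] = 0%E].

Definition dist_to (R : realType) (n : nat) (x : 'rV[R]_n)
    (A : set 'rV[R]_n) : R :=
  inf [set enorm (x - y) | y in A].

Definition inradius (R : realType) (n : nat) (Om : set 'rV[R]_n) : R :=
  sup [set dist_to x (boundary Om) | x in Om].

(* [c] is the centre of a largest ball inscribed in [Om]. The eigenvalues and
   the volume do not see translations of [Om], so a limit of ground states can
   only be identified after recentring; this is the point to recentre at. *)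
Definition incentre (R : realType) (n : nat) (Om : set 'rV[R]_n)
    (c : 'rV[R]_n) : Prop :=
  Om c /\ dist_to c (boundary Om) = inradius Om.

Definition lambdaD (R : realType) (n : nat) (Om : set 'rV[R]_n) : R :=
  (inradius Om)^-1.

(* The supremum, over the subdivisions 0 < s_0 < ... < s_m = 1 of the unit
   interval, of the length of the inscribed polygonal line. *)
Definition curve_length (R : realType) (n : nat) (g : R -> 'rV[R]_n) : \bar R :=
  ereal_sup [set (\sum_(i < size s)
      enorm (g (nth 0 s i) - g (nth 0 (0 :: s) i)))%:E
    | s in [set s : seq R | itv_partition 0 1 s]].

(* [+oo] when no Lipschitz curve in the closure joins [x] to [y]. *)
Definition geodist (R : realType) (n : nat) (Om : set 'rV[R]_n)
    (x y : 'rV[R]_n) : \bar R :=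
  ereal_inf [set curve_length g | g in [set g : R -> 'rV[R]_n |
    [/\ [lipschitz g t | t in `[0, 1]], g 0 = x, g 1 = y
      & forall t, 0 <= t <= 1 -> closure Om (g t)]]].

Definition intrinsic_diam (R : realType) (n : nat) (Om : set 'rV[R]_n) : \bar R :=
  ereal_sup [set d | exists x y,
    [/\ closure Om x, closure Om y & d = geodist Om x y]].

(* If the intrinsic diameter is [+oo] this is 2 / 0 = 0, in agreement with the
   convention 2 / oo = 0. *)
Definition lambdaN (R : realType) (n : nat) (Om : set 'rV[R]_n) : R :=
  2 / fine (intrinsic_diam Om).

Section differential_operators.
Variables (R : realType) (n : nat).
Implicit Types (phi : 'rV[R]_n -> R) (x : 'rV[R]_n) (i j : 'I_n).

Definition partial i phi : 'rV[R]_n -> R := fun x => 'D_(delta_mx 0 i) phi x.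

Definition grad phi x : 'rV[R]_n := \row_i partial i phi x.

Definition hessian phi x : 'M[R]_n :=
  \matrix_(i, j) partial j (partial i phi) x.

Definition infty_laplacian phi x : R :=
  (grad phi x *m hessian phi x *m (grad phi x)^T) 0 0.

Definition C1_on (U : set 'rV[R]_n) phi : Prop :=
  forall x, U x -> {for x, continuous phi} /\
    forall i, derivable phi x (delta_mx 0 i) /\
              {for x, continuous (partial i phi)}.

Definition C2_on (U : set 'rV[R]_n) phi : Prop :=
  C1_on U phi /\ forall i, C1_on U (partial i phi).

End differential_operators.

Section ground_states.
Variables (R : realType) (n : nat).
Implicit Types (Om : set 'rV[R]_n) (u : 'rV[R]_n -> R) (lam : R).

(* min {- Delta_oo phi, |grad phi| - lam u}, at a point where the test
   function [phi] touches [u] *)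
Definition eigen_operator lam u (phi : 'rV[R]_n -> R) (x : 'rV[R]_n) : R :=
  Num.min (- infty_laplacian phi x) (enorm (grad phi x) - lam * u x).

Definition viscosity_subsolution lam Om u : Prop :=
  forall (x0 : 'rV[R]_n) (U : set 'rV[R]_n) (phi : 'rV[R]_n -> R),
    Om x0 -> open U -> U x0 -> C2_on U phi ->
    phi x0 = u x0 -> (\forall x \near x0, u x <= phi x) ->
    eigen_operator lam u phi x0 <= 0.

Definition viscosity_supersolution lam Om u : Prop :=
  forall (x0 : 'rV[R]_n) (U : set 'rV[R]_n) (phi : 'rV[R]_n -> R),
    Om x0 -> open U -> U x0 -> C2_on U phi ->
    phi x0 = u x0 -> (\forall x \near x0, phi x <= u x) ->
    0 <= eigen_operator lam u phi x0.

(* Only the values of [u] on the closure of [Om] matter. *)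
Definition infty_ground_state Om u : Prop :=
  [/\ {within closure Om, continuous u},
      viscosity_subsolution (lambdaD Om) Om u,
      viscosity_supersolution (lambdaD Om) Om u,
      forall x, boundary Om x -> u x = 0
    & exists x, Om x /\ u x != 0].

Definition normalized_ground_state Om u : Prop :=
  infty_ground_state Om u /\ Linfty_norm Om u = 1%E.

End ground_states.

Definition v_infty (R : realType) (n : nat) (r : R) (x : 'rV[R]_n) : R :=
  1 - enorm x / r.

Definition zero_extension (R : realType) (n : nat) (Om : set 'rV[R]_n)
    (u : 'rV[R]_n -> R) : 'rV[R]_n -> R :=
  patch (fun=> 0) Om u.

Definition locally_uniformly (R : realType) (n : nat) (B : set 'rV[R]_n)
    (f : nat -> 'rV[R]_n -> R) (g : 'rV[R]_n -> R) : Prop :=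
  forall x, B x -> exists2 U, nbhs x U & {uniform U, f @ \oo --> g}.

(* Main.v *)
Require Import Defs.
From mathcomp Require Import all_boot all_order all_algebra.
From mathcomp Require Import all_classical all_reals all_analysis.
From mathcomp Require Import ring lra.
Import Order.TTheory GRing.Theory Num.Theory.
Import numFieldNormedType.Exports.
Local Open Scope classical_set_scope.
Local Open Scope ring_scope.

Set Implicit Arguments.
Unset Strict Implicit.
Unset Printing Implicit Defensive.

(** The whole theorem rests on two comparisons of a normalized ground state [u]
    of a domain [Om] with cones of slope [lambdaD Om].

    From above: for [y] outside [Om], a cone of slope slightly larger than
    [lambdaD Om] and vertex [y], bent to be strictly concave along the rays, is a
    strict supersolution of the eigenvalue equation, because [u <= 1]. It is
    nonnegative on the boundary, so it cannot be crossed by [u]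
    ([subsolution_le_cone]), and [u x <= lambdaD Om * enorm (x - y)]. In
    particular the points [m] where [u m = 1] are at distance at least
    [(lambdaD Om)^-1] from the boundary.

    From below: [u] is infinity-superharmonic, so it lies above every cone with
    vertex at such a point [m] that is nonpositive on the boundary
    ([supersolution_ge_cone]), and [1 - lambdaD Om * enorm (x - m) <= u x].

    If [Om] lies in a ball of centre [c] and radius [rho], the upper bound places
    [m] within [rho - (lambdaD Om)^-1] of [c], and both bounds together say that
    [u] differs from [1 - lambdaD Om * enorm (x - c)] by at most
    [rho * lambdaD Om - 1] ([ground_state_close_to_cone]). For the ball of radius
    [r] this error is zero, which is the uniqueness statement.

    For the convergence, let [c] be an incentre. The inscribed ball about [c]
    contains points opposite to any point [x] of [Om], so the diameter [D] bounds
    [enorm (x - c) + inradius Om] and one can take [rho = D - inradius Om]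
    ([incentre_outer_radius]). The error is then
    [2 * lambdaD Om / lambdaN Om - 2], which tends to zero since both eigenvalues
    tend to [r^-1].

    No doubling of variables is involved: the comparison functions are explicit,
    and at a contact point they are replaced by quadratic polynomials
    ([bent_cone_near_le]). Measure theory enters only through the essential
    supremum in the normalization: it is a maximum as soon as nonempty open
    subsets of [Om] are not null, and if one of them were null then, by scaling,
    [Om] would be null too ([lebesgueRn_null_nbhs]), so that the essential
    supremum would be [-oo].

    That the cone [v_infty] is a ground state of the ball is checked on test
    functions: off the vertex a test function that touches it has a radial
    gradient, and its second derivative along the ray has the right sign
    ([cone_contact_above], [cone_contact_below]). *)

(** * Euclidean geometry of row vectors *)

Section euclidean_space.
Variables (R : realType) (n : nat).
Implicit Types (x y z : 'rV[R]_n) (a : R).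

Definition dot x y : R := \sum_i x 0 i * y 0 i.

Lemma dotC x y : dot x y = dot y x.
Proof. by apply: eq_bigr => i _; rewrite mulrC. Qed.

Lemma dotDl x y z : dot (x + y) z = dot x z + dot y z.
Proof. by rewrite -big_split; apply: eq_bigr => i _; rewrite mxE mulrDl. Qed.

Lemma dotZl a x y : dot (a *: x) y = a * dot x y.
Proof. by rewrite mulr_sumr; apply: eq_bigr => i _; rewrite mxE mulrA. Qed.

Lemma dotDr x y z : dot x (y + z) = dot x y + dot x z.
Proof. by rewrite dotC dotDl !(dotC x). Qed.

Lemma dotZr a x y : dot x (a *: y) = a * dot x y.
Proof. by rewrite dotC dotZl dotC. Qed.

Lemma dotNl x y : dot (- x) y = - dot x y.
Proof. by rewrite -scaleN1r dotZl mulN1r. Qed.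

Lemma dotNr x y : dot x (- y) = - dot x y.
Proof. by rewrite dotC dotNl dotC. Qed.

Lemma dot_ge0 x : 0 <= dot x x.
Proof. by apply: sumr_ge0 => i _; rewrite -expr2 sqr_ge0. Qed.

Lemma enormE x : enorm x = Num.sqrt (dot x x).
Proof. by congr Num.sqrt; apply: eq_bigr => i _; rewrite expr2. Qed.

Lemma enorm_ge0 x : 0 <= enorm x.
Proof. exact: sqrtr_ge0. Qed.

Lemma sqr_enorm x : enorm x ^+ 2 = dot x x.
Proof. by rewrite enormE sqr_sqrtr ?dot_ge0. Qed.

Lemma enormZ a x : enorm (a *: x) = `|a| * enorm x.
Proof.
by rewrite !enormE dotZl dotZr mulrA -expr2 sqrtrM ?sqr_ge0// sqrtr_sqr.
Qed.

Lemma enorm0 : enorm (0 : 'rV[R]_n) = 0.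
Proof. by rewrite -(scale0r (0 : 'rV[R]_n)) enormZ normr0 mul0r. Qed.

Lemma enormN x : enorm (- x) = enorm x.
Proof. by rewrite -scaleN1r enormZ normrN1 mul1r. Qed.

Lemma enormB x y : enorm (x - y) = enorm (y - x).
Proof. by rewrite -enormN opprB. Qed.

Lemma coord_le_enorm x i : `|x 0 i| <= enorm x.
Proof.
rewrite -(ler_pXn2r (n := 2)) ?nnegrE ?enorm_ge0// sqr_enorm real_normK ?num_real//.
by rewrite /dot (bigD1 i)//= -expr2 lerDl sumr_ge0// => j _; rewrite -expr2 sqr_ge0.
Qed.

Lemma enorm_eq0 x : (enorm x == 0) = (x == 0).
Proof.
apply/eqP/eqP => [x0|->]; last exact: enorm0.
by apply/rowP => i; rewrite mxE; apply/eqP; rewrite -normr_le0 -x0 coord_le_enorm.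
Qed.

Lemma enorm_gt0 x : (0 < enorm x) = (x != 0).
Proof. by rewrite lt_def enorm_ge0 andbT enorm_eq0. Qed.

Lemma cauchy_schwarz x y : dot x y <= enorm x * enorm y.
Proof.
have [->|x0] := eqVneq x 0.
  by rewrite -{1}(scale0r 0) dotZl mul0r mulr_ge0 ?enorm_ge0.
have [->|y0] := eqVneq y 0.
  by rewrite -{1}(scale0r 0) dotZr mul0r mulr_ge0 ?enorm_ge0.
have := dot_ge0 (enorm y *: x - enorm x *: y).
rewrite !(dotDl, dotDr, dotNl, dotNr, dotZl, dotZr) -!sqr_enorm (dotC y x).
move: x0 y0; rewrite -!enorm_gt0.
move: (enorm x) (enorm y) (dot x y) => a b d a0 b0 H.
have {}H : 0 <= (a * b) * (a * b - d) by nra.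
by rewrite pmulr_rge0 ?mulr_gt0// subr_ge0 in H.
Qed.

Lemma ler_enormD x y : enorm (x + y) <= enorm x + enorm y.
Proof.
rewrite -(ler_pXn2r (n := 2)) ?nnegrE ?addr_ge0 ?enorm_ge0//.
rewrite sqr_enorm dotDl !dotDr (dotC y x) sqrrD !sqr_enorm mulr2n.
by have := cauchy_schwarz x y; lra.
Qed.

Lemma ler_enorm_dist z x y : enorm (x - y) <= enorm (x - z) + enorm (z - y).
Proof. by rewrite (le_trans _ (ler_enormD _ _))// addrA subrK. Qed.

Lemma ler_dist_enorm x y : `|enorm x - enorm y| <= enorm (x - y).
Proof.
rewrite ler_norml; apply/andP; split.
  by have := ler_enormD (y - x) x; rewrite subrK (enormB x); lra.
by have := ler_enormD (x - y) y; rewrite subrK; lra.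
Qed.

Lemma enorm_le_norm x : enorm x <= n%:R * `|x|.
Proof.
have coord i : `|x 0 i| <= `|x|.
  by rewrite [leRHS]/Num.norm/= mx_normrE; apply/bigmax_geP; right; exists (0, i).
rewrite -(ler_pXn2r (n := 2)) ?nnegrE ?enorm_ge0 ?mulr_ge0//.
rewrite sqr_enorm exprMn.
have le1 : dot x x <= \sum_(i < n) `|x| ^+ 2.
  apply: ler_sum => i _; rewrite -expr2 -(real_normK (num_real (x 0 i))).
  by rewrite lerXn2r ?nnegrE// coord.
rewrite (le_trans le1)// sumr_const card_ord -[leLHS]mulr_natl ler_wpM2r ?sqr_ge0//.
by rewrite -natrX ler_nat -[leqLHS]expn1; case: (n) => // m; rewrite leq_pexp2l.
Qed.

Lemma norm_le_enorm x : `|x| <= enorm x.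
Proof.
rewrite [leLHS]/Num.norm/= mx_normrE; apply/bigmax_leP; split=> [|[i j] _].
  exact: enorm_ge0.
by rewrite (ord1 i)/= coord_le_enorm.
Qed.

(** The Euclidean balls generate the topology, which is the one of the sup
    norm. *)
Lemma near_enormP x (P : set 'rV[R]_n) :
  (\forall y \near x, P y) <->
  exists2 e, 0 < e & forall y, enorm (y - x) < e -> P y.
Proof.
split=> [/nbhs_ballP[e /= e0 eP]|[e e0 eP]].
  exists e => // y yx; apply: eP; rewrite -ball_normE/= distrC.
  exact: le_lt_trans (norm_le_enorm _) yx.
apply/nbhs_ballP; exists (e / n.+1%:R) => [|y]; first by rewrite /= divr_gt0.
rewrite -ball_normE/= distrC => yx; apply: eP.
rewrite (le_lt_trans (enorm_le_norm _))//.
move: yx; rewrite ltr_pdivlMr// => yx; apply: le_lt_trans yx.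
by rewrite mulrC ler_wpM2l// ler_nat.
Qed.

Lemma near_enorm_lt x e : 0 < e -> \forall y \near x, enorm (y - x) < e.
Proof. by move=> e0; apply/near_enormP; exists e. Qed.

Lemma open_enormP (A : set 'rV[R]_n) x : open A -> A x ->
  exists2 e, 0 < e & forall y, enorm (y - x) < e -> A y.
Proof. by move=> oA Ax; apply/near_enormP; exact: open_nbhs_nbhs. Qed.

Lemma closure_enormP (A : set 'rV[R]_n) x :
  closure A x <-> forall e, 0 < e -> exists2 y, A y & enorm (y - x) < e.
Proof.
split=> [Ax e e0|Ax B /near_enormP[e e0 eB]].
  by have [y []] := Ax _ (near_enorm_lt x e0); exists y.
by have [y Ay /eB] := Ax e e0; exists y.
Qed.

Lemma continuous_enormB y : continuous (fun x => enorm (x - y)).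
Proof.
move=> x; have FF := nbhs_filter x; apply/cvgrPdist_lt => e e0.
apply: filterS (near_enorm_lt x e0) => z zx.
by rewrite (le_lt_trans (ler_dist_enorm _ _))// opprB addrA subrK enormB.
Qed.

Lemma continuous_sqr_enormB y : continuous (fun x => enorm (x - y) ^+ 2).
Proof.
move=> x.
apply: (@continuous_comp _ _ _ (fun z => enorm (z - y)) (@GRing.exp R ^~ 2)).
  exact: continuous_enormB.
exact: exprn_continuous.
Qed.

Lemma bounded_enormP (A : set 'rV[R]_n) :
  bounded_set A <-> exists M, forall x, A x -> enorm x <= M.
Proof.
split=> [[M [_ AM]]|[M AM]].
  exists (n%:R * (M + 1)) => x Ax; rewrite (le_trans (enorm_le_norm _))//.
  by rewrite ler_wpM2l// (AM (M + 1)) ?ltrDl.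
exists M; split; first exact: num_real.
move=> N MN x Ax /=; rewrite (le_trans (norm_le_enorm _))//.
by rewrite (le_trans (AM x Ax))// ltW.
Qed.

Lemma closure_enorm_le (A : set 'rV[R]_n) y M :
  (forall x, A x -> enorm (x - y) <= M) ->
  forall x, closure A x -> enorm (x - y) <= M.
Proof.
move=> AM x /closure_enormP clAx; apply/ler_addgt0Pr => e e0.
have [z Az zx] := clAx e e0.
by rewrite (le_trans (ler_enorm_dist z _ _))// enormB addrC lerD ?AM// ltW.
Qed.

Lemma compact_closure (A : set 'rV[R]_n) : bounded_set A -> compact (closure A).
Proof.
move=> /bounded_enormP[M AM]; apply: bounded_closed_compact;
  last exact: closed_closure.
apply/bounded_enormP; exists M => x Ax.
rewrite -(subr0 x); apply: closure_enorm_le Ax => z Az.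
by rewrite subr0 AM.
Qed.

Lemma open_boundary (A : set 'rV[R]_n) x : open A ->
  closure A x -> A x \/ boundary A x.
Proof.
move=> oA clAx; have [Ax|nAx] := pselect (A x); first by left.
by right; split => //; rewrite (interior_id A).1.
Qed.

Lemma open_boundaryF (A : set 'rV[R]_n) x : open A -> boundary A x -> ~ A x.
Proof. by move=> oA [_]; rewrite (interior_id A).1. Qed.

(** Polar coordinates; the origin has them too, which needs a direction to
    exist. *)
Lemma polar (hn : (0 < n)%N) x :
  exists2 e : 'rV[R]_n, enorm e = 1 & x = enorm x *: e.
Proof.
have [->|x0] := eqVneq x 0.
  exists (delta_mx 0 (Ordinal hn)); last by rewrite enorm0 scale0r.
  rewrite enormE /dot (bigD1 (Ordinal hn))//= big1 => [|i ne].
    by rewrite !mxE !eqxx mulr1 addr0 sqrtr1.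
  by rewrite !mxE (negbTE ne) andbF mul0r.
have nx0 : enorm x != 0 by rewrite enorm_eq0.
exists ((enorm x)^-1 *: x); last by rewrite scalerA divff// scale1r.
by rewrite enormZ ger0_norm ?invr_ge0 ?enorm_ge0// mulVf.
Qed.

(** The distance to the origin is bounded near [d *: e], to second order, by a
    quadratic polynomial that is affine in the radial direction [e]. Through
    this bound, radial comparison functions yield polynomial test functions. *)
Lemma enorm_radial_le d (e z : 'rV[R]_n) : 0 < d -> enorm e = 1 ->
  enorm z < d / 2 ->
  enorm (d *: e + z) <= d + dot e z + (dot z z - dot e z ^+ 2) / d.
Proof.
move=> d0 e1 zd.
have ee : dot e e = 1 by rewrite -sqr_enorm e1 expr1n.
have := cauchy_schwarz e z; have := cauchy_schwarz e (- z).
rewrite dotNr enormN e1 mul1r => s1 s2.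
have ts : dot e z ^+ 2 <= dot z z.
  rewrite -sqr_enorm -(real_normK (num_real (dot e z))).
  rewrite lerXn2r ?nnegrE ?enorm_ge0// ler_norml.
  by apply/andP; split; lra.
have t0 : 0 <= (dot z z - dot e z ^+ 2) / d by rewrite divr_ge0 ?subr_ge0// ltW.
rewrite -(ler_pXn2r (n := 2)) ?nnegrE ?enorm_ge0//; last by lra.
rewrite sqr_enorm !(dotDl, dotDr, dotZl, dotZr) ee (dotC z e).
set t := (_ / d) in t0 *.
have -> : dot z z = t * d + dot e z ^+ 2 by rewrite divfK ?gt_eqF// subrK.
by nra.
Qed.

End euclidean_space.

(** * Quadratic test functions *)

Section quadratic_polynomials.
Variables (R : realType) (n : nat).
Implicit Types (x y z e b v : 'rV[R]_n) (a c d : R).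

(** An exact second-order expansion along [v] yields the derivative without
    any calculus of products and compositions. *)
Lemma is_derive_second_order (f : 'rV[R]_n -> R) x v a d :
  (forall h, f (h *: v + x) = f x + h * a + h ^+ 2 * d) -> is_derive x v f a.
Proof.
move=> fE.
have cv : h^-1 *: ((f \o shift x) (h *: v) - f x) @[h --> 0^'] --> a.
  have /cvg_trans : h^-1 *: ((f \o shift x) (h *: v) - f x) @[h --> 0^'] `=>`
      (a + h * d) @[h --> 0^'].
    apply: near_eq_cvg; near=> h.
    rewrite /= fE /GRing.scale/=.
    have h0 : h != 0 by near: h; exact: nbhs_dnbhs_neq.
    by field.
  apply; apply: cvg_within_filter.
  have : (a + h * d) @[h --> 0] --> a + 0 * d.
    by apply: cvgD; [exact: cvg_cst|apply: cvgM; [exact: cvg_id|exact: cvg_cst]].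
  by rewrite mul0r addr0.
apply: DeriveDef; first by apply/cvg_ex; exists a.
exact: cvg_lim.
Unshelve. all: by end_near. Qed.

(** This family is closed under partial derivatives, which gives its regularity
    and its Hessian at once. *)
Definition quad x0 c b e be ga : 'rV[R]_n -> R :=
  fun x => c + dot b (x - x0) + be * dot e (x - x0) ^+ 2
           + ga * dot (x - x0) (x - x0).

Lemma dot_delta x i : dot x (delta_mx 0 i) = x 0 i.
Proof.
rewrite /dot (bigD1 i)//= !mxE !eqxx mulr1 big1 ?addr0// => j ji.
by rewrite !mxE (negbTE ji) andbF mulr0.
Qed.

Lemma is_derive_quad x0 c b e be ga x v :
  is_derive x v (quad x0 c b e be ga)
    (dot b v + 2 * be * dot e (x - x0) * dot e v + 2 * ga * dot (x - x0) v).
Proof.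
apply: (@is_derive_second_order _ _ _ _ (be * dot e v ^+ 2 + ga * dot v v)) => h.
rewrite /quad -[h *: v + x - x0]addrA; move: (x - x0) => z.
by rewrite !(dotDl, dotDr, dotZl, dotZr) (dotC v z); ring.
Qed.

Lemma continuous_quad x0 c b e be ga : continuous (quad x0 c b e be ga).
Proof.
have cdot w : continuous (fun x => dot w (x - x0)).
  move=> x; have FF := nbhs_filter x; apply/cvgrPdist_lt => a a0.
  have w0 : 0 < enorm w + 1 by rewrite ltr_wpDl ?enorm_ge0.
  apply: filterS (near_enorm_lt x (divr_gt0 a0 w0)) => z.
  rewrite ltr_pdivlMr// => zx; rewrite -dotNr -dotDr opprB addrA subrK.
  apply: le_lt_trans zx; apply: (@le_trans _ _ (enorm w * enorm (z - x))).
    rewrite ler_norml; apply/andP; split.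
      rewrite lerNl -dotNr opprB; exact: cauchy_schwarz.
    by rewrite (enormB z) cauchy_schwarz.
  by rewrite mulrC ler_wpM2l ?enorm_ge0// lerDl.
move=> x; have FF := nbhs_filter x; rewrite /quad.
apply: cvgD; last first.
  apply: cvgM; first exact: cvg_cst.
  rewrite [X in X @ _ --> _](_ : _ = (fun z => enorm (z - x0) ^+ 2)); last first.
    by apply/funext => z; rewrite sqr_enorm.
  rewrite -sqr_enorm; exact: continuous_sqr_enormB.
apply: cvgD.
  by apply: cvgD; [exact: cvg_cst|exact: cdot].
apply: cvgM; first exact: cvg_cst.
apply: (@continuous_comp _ _ _ (fun z => dot e (z - x0)) (@GRing.exp R ^~ 2)).
  exact: cdot.
exact: exprn_continuous.
Qed.

Lemma partial_quad x0 c b e be ga i :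
  partial i (quad x0 c b e be ga) =
  quad x0 (b 0 i) ((2 * be * e 0 i) *: e + (2 * ga) *: delta_mx 0 i) e 0 0.
Proof.
apply/funext => x; rewrite /partial.
rewrite (@derive_val _ _ _ _ _ _ _ (is_derive_quad x0 c b e be ga x (delta_mx 0 i))).
rewrite /quad; move: (x - x0) => z.
rewrite !dot_delta dotDl !dotZl (dotC (delta_mx 0 i)) dot_delta.
by rewrite !mul0r; ring.
Qed.

Lemma C2_on_quad U x0 c b e be ga : C2_on U (quad x0 c b e be ga).
Proof.
have C1 c' b' be' ga' : C1_on U (quad x0 c' b' e be' ga').
  move=> x _; split=> [|i]; first exact: continuous_quad.
  split; last by rewrite partial_quad; exact: continuous_quad.
  exact: (@ex_derive _ _ _ _ _ _ _ (is_derive_quad _ _ _ _ _ _ _ _)).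
by split=> [|i]; [exact: C1|rewrite partial_quad; exact: C1].
Qed.

Lemma quad_center x0 c b e be ga : quad x0 c b e be ga x0 = c.
Proof.
have dot0 w : dot w 0 = 0 by rewrite -(scale0r 0) dotZr mul0r.
by rewrite /quad subrr !dot0 expr0n/= !mulr0 !addr0.
Qed.

Lemma grad_quad x0 c b e be ga : grad (quad x0 c b e be ga) x0 = b.
Proof. by apply/rowP => i; rewrite mxE partial_quad quad_center. Qed.

Lemma hessian_quad x0 c b e be ga :
  hessian (quad x0 c b e be ga) x0 =
  (2 * be) *: (e^T *m e) + (2 * ga)%:M.
Proof.
apply/matrixP => i j; rewrite !mxE 2!partial_quad quad_center !mxE big_ord1 !mxE.
by rewrite eqxx/= -mulrA (eq_sym i) mulr_natr.
Qed.

Lemma infty_laplacian_quad x0 c a e be ga : enorm e = 1 ->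
  infty_laplacian (quad x0 c (a *: e) e be ga) x0 = 2 * a ^+ 2 * (be + ga).
Proof.
move=> e1; rewrite /infty_laplacian grad_quad hessian_quad.
have ee : e *m e^T = 1.
  apply/matrixP => i j; rewrite !ord1 !mxE eqxx -[RHS](expr1n _ 2) -e1 sqr_enorm.
  by apply: eq_bigr => k _; rewrite !mxE.
rewrite linearZ/= mulmxDr mulmxDl -!scalemxAl -!scalemxAr !mulmxA ee mul1mx.
rewrite mul_mx_scalar -!scalemxAl ee !mxE eqxx/=.
ring.
Qed.

End quadratic_polynomials.

(** * Comparison with cones *)

Section comparison_with_cones.
Variables (R : realType) (n : nat).
Implicit Types (x y m : 'rV[R]_n) (Om : set 'rV[R]_n) (u : 'rV[R]_n -> R).

(** A radial function [g] of the distance to [y] has infinity-Laplacian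
    [g'' * g' ^+ 2]; for the bent cone this has the sign of [- d] wherever [g']
    does not vanish. *)
Definition bent_cone y (a d : R) x : R := a * enorm (x - y) - d * enorm (x - y) ^+ 2.

(** The test polynomial has gradient [(a - 2 * d * D) *: e] and radial second
    derivative [- 2 * d] at [x0], exactly as the bent cone: only the curvature
    across the rays has been increased, and the infinity-Laplacian does not
    see it. *)
Lemma bent_cone_near_le y (a d : R) x0 c : 0 <= a -> x0 != y ->
  let D := enorm (x0 - y) in let e := D^-1 *: (x0 - y) in
  \forall x \near x0, c + (bent_cone y a d x - bent_cone y a d x0) <=
    quad x0 c ((a - 2 * d * D) *: e) e (- (a / D)) (a / D - d) x.
Proof.
move=> a0 xy D e.
have D0 : 0 < D by rewrite enorm_gt0 subr_eq0.
have e1 : enorm e = 1 by rewrite enormZ gtr0_norm ?invr_gt0// mulVf ?gt_eqF.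
apply: filterS (near_enorm_lt x0 (divr_gt0 D0 (ltr0n _ 2))) => x /= xx0.
have De : D *: e = x0 - y by rewrite scalerA divff ?gt_eqF// scale1r.
have -> : bent_cone y a d x0 = a * D - d * D ^+ 2 by [].
rewrite /bent_cone /quad; set z := x - x0 in xx0 *.
have -> : x - y = D *: e + z by rewrite De /z [RHS]addrC addrA subrK.
clearbody z e D.
have := enorm_radial_le D0 e1 xx0.
rewrite sqr_enorm !(dotDl, dotDr, dotZl, dotZr) (dotC z e).
have -> : dot e e = 1 by rewrite -sqr_enorm e1 expr1n.
move: (dot e z) (dot z z) (enorm _) => s t N /(ler_wpM2l a0).
rewrite mulrDr mulrA.
have -> : (t - s ^+ 2) / D = t / D - s ^+ 2 / D by rewrite mulrBl.
by move: (D^-1) => iD; nra.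
Qed.

Section contact.
Variables (lam : R) (Om : set 'rV[R]_n) (u : 'rV[R]_n -> R).
Variables (a d : R) (x0 y : 'rV[R]_n).
Hypotheses (a0 : 0 <= a) (d0 : 0 < d) (Ox0 : Om x0) (x0y : x0 != y).

Lemma subsolution_contact : viscosity_subsolution lam Om u ->
  (\forall x \near x0, u x - bent_cone y a d x <= u x0 - bent_cone y a d x0) ->
  2 * d * enorm (x0 - y) < a -> a - 2 * d * enorm (x0 - y) <= lam * u x0.
Proof.
move=> sub umax; have /= := bent_cone_near_le d (u x0) a0 x0y.
set D := enorm _; set e := D^-1 *: _ => near_quad Da.
have e1 : enorm e = 1.
  by rewrite enormZ gtr0_norm ?invr_gt0 ?mulVf ?enorm_eq0 ?enorm_gt0 ?subr_eq0.
set b := _ - _ in near_quad *.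
have b0 : 0 < b by rewrite subr_gt0.
pose q := quad x0 (u x0) (b *: e) e (- (a / D)) (a / D - d).
have := sub x0 setT q Ox0 openT I (C2_on_quad _ _ _ _ _ _ _).
rewrite /q /eigen_operator quad_center infty_laplacian_quad// grad_quad enormZ e1 mulr1.
rewrite gtr0_norm// => /(_ erefl).
have nle : \forall x \near x0, u x <= q x.
  have FF := nbhs_filter x0.
  apply: filterS2 umax near_quad => x h1 h2; apply: le_trans h2.
  by move: h1; lra.
move=> /(_ nle); rewrite addrA addNr add0r mulrN opprK ge_min => /orP[|]; last by lra.
by rewrite leNgt mulr_gt0// mulr_gt0// exprn_gt0.
Qed.

Lemma supersolution_no_contact : viscosity_supersolution lam Om u ->
  (\forall x \near x0, u x0 + bent_cone y a d x0 <= u x + bent_cone y a d x) ->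
  a != 2 * d * enorm (x0 - y) -> False.
Proof.
move=> sup umin; have /= := bent_cone_near_le d (- u x0) a0 x0y.
set D := enorm _; set e := D^-1 *: _ => near_quad Da.
have e1 : enorm e = 1.
  by rewrite enormZ gtr0_norm ?invr_gt0 ?mulVf ?enorm_eq0 ?enorm_gt0 ?subr_eq0.
set b := _ - _ in near_quad *.
have b0 : b != 0 by rewrite subr_eq0.
pose q := quad x0 (u x0) (- b *: e) e (a / D) (d - a / D).
have := sup x0 setT q Ox0 openT I (C2_on_quad _ _ _ _ _ _ _).
rewrite /q /eigen_operator quad_center infty_laplacian_quad// => /(_ erefl).
have nle : \forall x \near x0, q x <= u x.
  have FF := nbhs_filter x0.
  apply: filterS2 umin near_quad => x; rewrite /q /quad scaleNr dotNl.
  by move: (dot (x - x0) _) => t; lra.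
move=> /(_ nle); rewrite addrC subrK le_min oppr_ge0 sqrrN => /andP[+ _].
by rewrite leNgt mulr_gt0// mulr_gt0// exprn_even_gt0.
Qed.

End contact.

Lemma continuous_bent_cone y a d : continuous (bent_cone y a d).
Proof.
move=> x; have FF := nbhs_filter x; rewrite /bent_cone.
apply: cvgB.
  by apply: cvgM; [exact: cvg_cst|exact: continuous_enormB].
by apply: cvgM; [exact: cvg_cst|exact: continuous_sqr_enormB].
Qed.

Section bounds.
Variables (lam : R) (Om : set 'rV[R]_n) (u : 'rV[R]_n -> R).
Hypotheses (hn : (0 < n)%N) (oOm : open Om) (bOm : bounded_set Om).
Hypotheses (cu : {within closure Om, continuous u})
  (u0 : forall x, boundary Om x -> u x = 0).

Lemma EVT_min_closure (f : 'rV[R]_n -> R) : Om !=set0 ->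
  {within closure Om, continuous f} ->
  exists2 x0, closure Om x0 & forall x, closure Om x -> f x0 <= f x.
Proof.
move=> [p Op] cf.
have ne : closure Om !=set0 by exists p; exact: subset_closure.
have [x0 x0P xmin] := EVT_min_rV ne (compact_closure bOm) cf.
by exists x0 => [|x xP]; [exact: set_mem|exact/xmin/mem_set].
Qed.

Lemma enorm_closure_bound y :
  exists2 D, 0 < D & forall x, closure Om x -> enorm (x - y) <= D.
Proof.
have /bounded_enormP[M OmM] := bOm.
exists (Num.max 1 (M + enorm y)); first by rewrite lt_max ltr01.
apply: closure_enorm_le => x Ox; rewrite le_max; apply/orP; right.
by rewrite (le_trans (ler_enormD _ _))// enormN lerD2r OmM.
Qed.

Lemma exterior_point : exists y, ~ Om y.
Proof.
have [e e1 _] := polar hn (0 : 'rV[R]_n).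
have [D D0 OmD] := enorm_closure_bound 0.
exists ((D + 1) *: e) => /subset_closure /OmD.
by rewrite subr0 enormZ e1 mulr1 gtr0_norm; lra.
Qed.

(** Bent cones with vertex [y] outside the domain and slope slightly above [A]
    are strict supersolutions, so [u] stays below them. *)
Lemma subsolution_le_cone (A : R) y : 0 <= A ->
  viscosity_subsolution lam Om u ->
  (forall x, Om x -> lam * u x <= A) -> ~ Om y ->
  forall x, Om x -> u x <= A * enorm (x - y).
Proof.
move=> A0 sub uA nOy x1 Ox1; rewrite leNgt; apply/negP => gap0.
have [D D0 OmD] := enorm_closure_bound y.
pose gap := u x1 - A * enorm (x1 - y).
pose d := gap / ((2 * D + 1) * D + 1).
have den0 : 0 < (2 * D + 1) * D + 1 by nra.
have d0 : 0 < d by rewrite divr_gt0 ?subr_gt0.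
have dE : d * ((2 * D + 1) * D + 1) = gap by rewrite divfK ?gt_eqF.
pose a := A + 2 * d * D + d.
have a0 : 0 <= a by rewrite /a; have := mulr_gt0 d0 D0; lra.
have [||x0 x0P xmin] := @EVT_min_closure (fun x => bent_cone y a d x - u x).
- by exists x1.
- move=> x; apply: cvgB; last exact: cu.
  exact/continuous_subspaceT/continuous_bent_cone.
have := xmin _ (subset_closure Ox1).
have := OmD _ x0P; have := enorm_ge0 (x0 - y).
have := OmD _ (subset_closure Ox1); have := enorm_ge0 (x1 - y).
have [Ox0|/u0 ux0] := open_boundary oOm x0P; last first.
  rewrite ux0 /bent_cone; move: dE; rewrite /gap /a.
  move: (enorm (x1 - y)) (enorm (x0 - y)) => t s dE t0 tD s0 sD h.
  have dDs : 0 <= d * (2 * D - s) by rewrite mulr_ge0 ?ltW//; lra.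
  have ws : 0 <= s * (A + d * (2 * D - s) + d) by rewrite mulr_ge0//; lra.
  have wt : d * ((2 * D + 1) * t) <= d * ((2 * D + 1) * D).
    by rewrite ler_pM2l// ler_wpM2l//; lra.
  have t2 : 0 <= d * t ^+ 2 by rewrite mulr_ge0 ?sqr_ge0// ltW.
  by nra.
move=> _ _ s0 sD _.
have x0y : x0 != y by apply/eqP => x0y; apply: nOy; rewrite -x0y.
have umax : \forall x \near x0, u x - bent_cone y a d x <= u x0 - bent_cone y a d x0.
  have FF := nbhs_filter x0.
  apply: filterS (open_nbhs_nbhs (conj oOm Ox0)) => x Ox.
  by have := xmin x (subset_closure Ox); lra.
have dsD : d * enorm (x0 - y) <= d * D by rewrite ler_pM2l.
have := subsolution_contact a0 d0 Ox0 x0y sub umax.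
by have := uA _ Ox0; rewrite /a; lra.
Qed.

(** The concave paraboloid [- d * enorm (x - y) ^+ 2], where [y] is outside the
    domain, is the bent cone of slope zero; for small [d], its sum with a [u]
    that is negative somewhere has its minimum inside the domain. *)
Lemma supersolution_ge0 : viscosity_supersolution lam Om u ->
  forall x, Om x -> 0 <= u x.
Proof.
move=> sup x1 Ox1; rewrite leNgt; apply/negP => ux1.
have [y nOy] := exterior_point.
have [D D0 OmD] := enorm_closure_bound y.
pose d := - u x1 / (D ^+ 2 + 1).
have den0 : 0 < D ^+ 2 + 1 by nra.
have d0 : 0 < d by rewrite divr_gt0 ?oppr_gt0.
have dE : d * (D ^+ 2 + 1) = - u x1 by rewrite divfK ?gt_eqF.
have [||x0 x0P xmin] := @EVT_min_closure (fun x => u x + bent_cone y 0 d x).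
- by exists x1.
- move=> x; apply: cvgD; first exact: cu.
  exact/continuous_subspaceT/continuous_bent_cone.
have x1min := xmin _ (subset_closure Ox1).
have [Ox0|/u0 ux0] := open_boundary oOm x0P; last first.
  move: x1min; rewrite ux0 /bent_cone !mul0r !sub0r.
  have := OmD _ x0P; have := enorm_ge0 (x0 - y); have := enorm_ge0 (x1 - y).
  move: (enorm (x1 - y)) (enorm (x0 - y)) => t s t0 s0 sD.
  have : s ^+ 2 <= D ^+ 2 by nra.
  have : 0 <= t ^+ 2 by nra.
  by nra.
have x0y : x0 != y by apply/eqP => x0y; apply: nOy; rewrite -x0y.
apply: (supersolution_no_contact (lexx 0) d0 Ox0 x0y sup).
  have FF := nbhs_filter x0.
  by apply: filterS (open_nbhs_nbhs (conj oOm Ox0)) => x /subset_closure /xmin.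
by rewrite eq_sym mulf_neq0 ?enorm_eq0 ?subr_eq0// mulf_neq0 ?gt_eqF.
Qed.

(** The cone with vertex [m], height [u m] and slope [A] is nonpositive on the
    boundary. Bent upwards, after a slight increase of the slope, it is a strict
    subsolution away from its vertex, so [u] stays above it. *)
Lemma supersolution_ge_cone (A : R) m : 0 < A ->
  viscosity_supersolution lam Om u -> Om m ->
  (forall y, boundary Om y -> u m <= A * enorm (y - m)) ->
  forall x, Om x -> u m - A * enorm (x - m) <= u x.
Proof.
move=> A0 sup Om_m mA x1 Ox1; rewrite leNgt; apply/negP => gap0.
have [D D0 OmD] := enorm_closure_bound m.
pose gap := u m - A * enorm (x1 - m) - u x1.
have gap_gt0 : 0 < gap by rewrite subr_gt0.
have [d d0 [d1 d2]] : exists2 d, 0 < d & d * D ^+ 2 < gap /\ d * D < A.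
  exists (Num.min (gap / (D ^+ 2 + 1)) (A / (D + 1))).
    by rewrite lt_min !divr_gt0//; nra.
  split.
    apply: (@le_lt_trans _ _ (gap / (D ^+ 2 + 1) * D ^+ 2)).
      by apply: ler_wpM2r; [exact: sqr_ge0|rewrite ge_min lexx].
    by rewrite mulrAC ltr_pdivrMr ?ltr_pM2l//; nra.
  apply: (@le_lt_trans _ _ (A / (D + 1) * D)).
    by apply: ler_wpM2r; [exact: ltW|rewrite ge_min lexx orbT].
  by rewrite mulrAC ltr_pdivrMr ?ltr_pM2l//; nra.
pose a := A + d * D.
have a0 : 0 <= a by rewrite /a; have := mulr_gt0 d0 D0; lra.
have [||x0 x0P xmin] := @EVT_min_closure (fun x => u x + bent_cone m a d x).
- by exists m.
- move=> x; apply: cvgD; first exact: cu.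
  exact/continuous_subspaceT/continuous_bent_cone.
have x0lt : u x0 + bent_cone m a d x0 < u m.
  have := xmin _ (subset_closure Ox1).
  have := OmD _ (subset_closure Ox1); have := enorm_ge0 (x1 - m).
  move: d1; rewrite /bent_cone /gap /a; move: (enorm (x1 - m)) => t dg t0 tD h.
  apply: le_lt_trans h _.
  have : 0 <= d * t ^+ 2 by nra.
  have : d * D * t <= d * D ^+ 2.
    by rewrite expr2 mulrA; apply: ler_wpM2l => //; rewrite ltW// mulr_gt0.
  by nra.
have x0D := OmD _ x0P.
have [Ox0|x0b] := open_boundary oOm x0P; last first.
  move: x0lt; rewrite (u0 x0b) /bent_cone; have := mA _ x0b.
  have := enorm_ge0 (x0 - m); move: x0D; rewrite /a.
  move: (enorm (x0 - m)) => t tD t0.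
  have : 0 <= d * t * (D - t) by rewrite mulr_ge0 ?subr_ge0// mulr_ge0// ltW.
  by nra.
have x0m : x0 != m.
  apply/eqP => x0m; move: x0lt.
  by rewrite x0m /bent_cone subrr enorm0 expr0n/= !mulr0 subr0 addr0 ltxx.
apply: (supersolution_no_contact a0 d0 Ox0 x0m sup).
  have FF := nbhs_filter x0.
  by apply: filterS (open_nbhs_nbhs (conj oOm Ox0)) => x /subset_closure /xmin.
have : d * enorm (x0 - m) <= d * D by rewrite ler_pM2l.
by move=> h; rewrite gt_eqF// /a; lra.
Qed.

End bounds.
End comparison_with_cones.

(** * Null sets and the essential supremum *)

Section outer_measure.
Variables (R : realType) (n : nat).
Implicit Types (A W : set 'rV[R]_n) (x : 'rV[R]_n).

Lemma box_sum_ge0 (a b : nat -> 'rV[R]_n) : (forall k i, a k 0 i <= b k 0 i) ->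
  (0 <= \sum_(0 <= k <oo) (\prod_i (b k 0 i - a k 0 i))%:E)%E.
Proof.
move=> ab; apply: nneseries_ge0 => k _ _.
by rewrite lee_fin prodr_ge0// => i _; rewrite subr_ge0.
Qed.

Lemma lebesgueRn_ge0 A : (0 <= lebesgueRn A)%E.
Proof. by apply: le_ereal_inf_tmp => _ [a [b [ab _ ->]]]; exact: box_sum_ge0. Qed.

Lemma lebesgueRn0 : (0 < n)%N -> lebesgueRn (set0 : set 'rV[R]_n) = 0%E.
Proof.
move=> hn; apply/eqP; rewrite eq_le lebesgueRn_ge0 andbT.
apply: ereal_inf_lbound; exists (fun=> 0), (fun=> 0); split=> //.
rewrite eseries0// => k _ _.
by rewrite (bigD1 (Ordinal hn))//= subrr mul0r.
Qed.

(** The preimage of a cover by boxes under a homothety is a cover by boxes. *)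
Lemma lebesgueRn_null_affine A W (t : R) (s : 'rV[R]_n) : 0 < t ->
  (forall x, W x -> A (t *: x + s)) -> lebesgueRn A = 0%E -> lebesgueRn W = 0%E.
Proof.
move=> t0 WA A0; apply/eqP; rewrite eq_le lebesgueRn_ge0 andbT.
apply/lee_addgt0Pr => e e0; rewrite add0e.
have : (lebesgueRn A < (e * t ^+ n)%:E)%E by rewrite A0 lte_fin mulr_gt0 ?exprn_gt0.
move=> /ereal_inf_ltP[_ [a [b [ab Aab ->]]] abe].
apply: (@le_trans _ _ ((t ^- n)%:E *
    \sum_(0 <= k <oo) (\prod_i (b k 0 i - a k 0 i))%:E)%E); last first.
  apply: le_trans (lee_wpmul2l _ (ltW abe)) _.
    by rewrite lee_fin invr_ge0 exprn_ge0 ?ltW.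
  by rewrite -EFinM mulrC mulfK// expf_neq0// gt_eqF.
apply: ereal_inf_lbound; exists (fun k => t^-1 *: (a k - s)).
exists (fun k => t^-1 *: (b k - s)).
split=> [k i|x /WA /Aab[k _ xab]|].
- by rewrite !mxE ler_pM2l ?invr_gt0// lerD2r.
- exists k => // i; have := xab i; rewrite !mxE !(mulrC t^-1).
  by rewrite ler_pdivrMr// ler_pdivlMr// mulrC lerBlDr lerBrDr.
- rewrite -nneseriesZl// => [|k _]; last first.
    by rewrite lee_fin prodr_ge0// => i _; rewrite subr_ge0.
  apply: eq_eseriesr => k _; rewrite -EFinM; congr EFin.
  have -> : t ^- n = \prod_(i < n) t^-1 by rewrite prodr_const card_ord exprVn.
  rewrite -big_split/=; apply: eq_bigr => i _; rewrite !mxE.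
  by ring.
Qed.

(** A small homothetic copy of a bounded set fits into any neighbourhood. *)
Lemma lebesgueRn_null_nbhs A W x : bounded_set W ->
  (\forall y \near x, A y) -> lebesgueRn A = 0%E -> lebesgueRn W = 0%E.
Proof.
move=> /bounded_enormP[M WM] /near_enormP[e e0 eA].
have M0 : 0 < `|M| + 1 by rewrite ltr_wpDl.
apply: (@lebesgueRn_null_affine _ _ (e / (`|M| + 1)) x); first exact: divr_gt0.
move=> y /WM yM; apply: eA; rewrite addrK enormZ gtr0_norm ?divr_gt0//.
rewrite mulrAC ltr_pdivrMr// ltr_pM2l//.
by rewrite (le_lt_trans yM)// (le_lt_trans (ler_norm M))// ltrDl.
Qed.

(** The set where [u] exceeds a number below its maximum is a neighbourhood
    of a maximum point. Such a set is not null, because otherwise the whole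
    domain would be. *)
Lemma Linfty_norm_max (Om : set 'rV[R]_n) (u : 'rV[R]_n -> R) m : (0 < n)%N ->
  open Om -> bounded_set Om -> lebesgueRn Om != 0%E -> Om m ->
  {for m, continuous u} -> (forall x, Om x -> `|u x| <= `|u m|) ->
  Linfty_norm Om u = `|u m|%:E.
Proof.
move=> hn oOm bOm Om0 Om_m cu umax; apply/eqP; rewrite eq_le; apply/andP; split.
  apply: ereal_inf_lbound => /=.
  rewrite [X in lebesgueRn X](_ : _ = set0) ?lebesgueRn0//.
  apply/seteqP; split=> // x [/umax]; rewrite lte_fin => h1 h2.
  by move: (le_lt_trans h1 h2); rewrite ltxx.
apply: le_ereal_inf_tmp => y /= null; rewrite leNgt; apply/negP => yu.
move/eqP: Om0; apply; apply: (lebesgueRn_null_nbhs (x := m) bOm _ null).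
suff near_y : \forall x \near m, (y < `|u x|%:E)%E.
  by apply: filterI near_y; exact: open_nbhs_nbhs.
move: yu {null}; case: y => [y|//|_]; last first.
  by apply: (@filterE _ (nbhs m) (nbhs_filter m)) => x; rewrite ltNye.
rewrite lte_fin => /(cvgr_gt _ (cvg_norm cu)).
by apply: (@filterS _ (nbhs m) (nbhs_filter m)) => x; rewrite lte_fin.
Qed.

Lemma Linfty_norm_null (Om : set 'rV[R]_n) (u : 'rV[R]_n -> R) :
  lebesgueRn Om = 0%E -> Linfty_norm Om u = -oo%E.
Proof.
move=> Om0; apply/eqP; rewrite -leeNy_eq; apply: ereal_inf_lbound => /=.
rewrite [X in lebesgueRn X](_ : _ = Om)//.
by apply/seteqP; split=> [x []//|x Ox]; split => //; rewrite ltNye.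
Qed.

End outer_measure.

(** * Ground states and inscribed balls *)

Section ground_state_estimates.
Variables (R : realType) (n : nat) (Om : set 'rV[R]_n) (u : 'rV[R]_n -> R).
Hypotheses (hn : (0 < n)%N) (oOm : open Om) (bOm : bounded_set Om).

(** An essential supremum equal to [1], rather than [-oo], shows that the domain
    is not null; so the essential supremum is the maximum. *)
Lemma ground_state_max_point : normalized_ground_state Om u ->
  (forall x, Om x -> 0 <= u x <= 1) /\ exists2 m, Om m & u m = 1.
Proof.
move=> [[cu _ sup u0 [p [Op up]]] uoo].
have u_ge0 := supersolution_ge0 hn oOm bOm cu u0 sup.
have cNu : {within closure Om, continuous (fun x => - u x)}.
  by move=> x; apply: cvgN; exact: cu.
have [||m mP] := @EVT_min_closure _ _ _ bOm (fun x => - u x); first by exists p.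
  exact: cNu.
move=> /= mmax; have {}mmax x : Om x -> u x <= u m.
  by move=> /subset_closure /mmax; rewrite lerN2.
have um0 : 0 < u m.
  by rewrite (lt_le_trans _ (mmax p Op))// lt_neqAle eq_sym up u_ge0.
have [Om_m|/u0 um] := open_boundary oOm mP; last by rewrite um ltxx in um0.
suff um1 : u m = 1.
  by split=> [x Ox|]; [rewrite u_ge0//= -um1 mmax|exists m].
have /(@Linfty_norm_max _ _ Om u m hn oOm bOm) : lebesgueRn Om != 0%E.
  by apply/eqP => /(Linfty_norm_null u); rewrite uoo.
move=> /(_ Om_m); rewrite uoo gtr0_norm// => h.
have um1 : 1%E = (u m)%:E.
  apply: h => [|x Ox]; last by rewrite ger0_norm ?mmax ?u_ge0.
  have := continuous_subspaceW (@subset_closure _ Om) cu.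
  by rewrite continuous_open_subspace// => /(_ _ (mem_set Om_m)).
by case: um1.
Qed.

(** A ground state is at most [lambdaD Om] times the distance to any exterior
    point. Hence its maximum points are at distance at least [(lambdaD Om)^-1]
    from the boundary and, by the upper bound for exterior points just outside
    the ball, at distance at most [rho - (lambdaD Om)^-1] from [c]. The ground
    state also lies above the cone of slope [lambdaD Om] with vertex at a
    maximum point, which is therefore close to the cone with vertex [c]. *)
Lemma ground_state_close_to_cone c rho : normalized_ground_state Om u ->
  0 < lambdaD Om -> (forall x, Om x -> enorm (x - c) <= rho) ->
  forall x, Om x ->
    `|u x - (1 - lambdaD Om * enorm (x - c))| <= rho * lambdaD Om - 1.
Proof.
move=> ngs lam0 Omrho.
have [[cu sub sup u0 _] _] := ngs; set lam := lambdaD Om in lam0 sub sup *.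
have [u01 [m Om_m um]] := ground_state_max_point ngs.
have below y : ~ Om y -> forall x, Om x -> u x <= lam * enorm (x - y).
  apply: (subsolution_le_cone oOm bOm cu u0 (ltW lam0) sub) => x /u01/andP[_ u1].
  by rewrite ger_pMr.
have upper x : Om x -> u x <= rho * lam - lam * enorm (x - c).
  move=> Ox; apply/ler_addgt0Pr => e e0.
  have [v v1 xv] := polar hn (x - c).
  (* The exterior point lies on the ray from [c] through [x], just outside the
     ball. *)
  pose s := rho + e / lam.
  have el0 : 0 < e / lam by rewrite divr_gt0.
  have s0 : 0 <= s by have := Omrho x Ox; have := enorm_ge0 (x - c); rewrite /s; lra.
  have nOy : ~ Om (c + s *: v).
    move=> /Omrho; rewrite addrC addKr enormZ v1 mulr1 ger0_norm// /s; lra.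
  apply: (le_trans (below _ nOy x Ox)).
  rewrite opprD addrA [X in X - _]xv -scalerBl enormZ v1 mulr1 ler0_norm; last first.
    by have := Omrho x Ox; rewrite /s; lra.
  by rewrite opprB /s mulrBr mulrDr [lam * (e / lam)]mulrC divfK ?gt_eqF//; lra.
have mc : lam * enorm (m - c) <= rho * lam - 1.
  by have := upper m Om_m; rewrite um; lra.
have lower := supersolution_ge_cone oOm bOm cu u0 lam0 sup Om_m.
move=> x Ox; have := lower _ x Ox; rewrite um => {}lower.
have {}lower : 1 - lam * enorm (x - m) <= u x.
  apply: lower => y yb; rewrite enormB -um; apply: below => //.
  exact: open_boundaryF yb.
have : lam * enorm (x - m) <= lam * (enorm (x - c) + enorm (m - c)).
  by rewrite ler_pM2l// (le_trans (ler_enorm_dist c _ _))// (enormB c).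
have := upper x Ox; rewrite ler_norml; move: lower mc; rewrite mulrDr.
by move=> *; apply/andP; split; lra.
Qed.

End ground_state_estimates.

Section inscribed_balls.
Variables (R : realType) (n : nat).
Hypothesis hn : (0 < n)%N.
Implicit Types (x y c : 'rV[R]_n) (Om A : set 'rV[R]_n).

Lemma dist_to_le x A y : A y -> dist_to x A <= enorm (x - y).
Proof.
move=> Ay; apply: ge_inf; last by exists y.
by exists 0 => _ [z _ <-]; exact: enorm_ge0.
Qed.

Lemma dist_to_ge x A (a : R) : A !=set0 ->
  (forall y, A y -> a <= enorm (x - y)) -> a <= dist_to x A.
Proof.
move=> [y Ay] aA; apply: lb_le_inf; first by exists (enorm (x - y)), y.
by move=> _ [z Az <-]; exact: aA.
Qed.

(** A point of the closure at maximal distance from the origin is not an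
    interior point. *)
Lemma boundary_nonempty Om : open Om -> bounded_set Om -> Om !=set0 ->
  boundary Om !=set0.
Proof.
move=> oOm bOm Om0.
have [|m mP mmax] := @EVT_min_closure _ _ Om bOm (fun x => - enorm (x - 0)) Om0.
  by move=> x; apply: cvgN; exact/continuous_subspaceT/continuous_enormB.
have [Om_m|mb] := open_boundary oOm mP; last by exists m.
have [v v1 mv] := polar hn m.
have [e e0 eOm] := open_enormP oOm Om_m.
have /subset_closure /mmax : Om (m + (e / 2) *: v).
  by apply: eOm; rewrite addrC addKr enormZ v1 mulr1 gtr0_norm; lra.
rewrite !subr0 [X in X + _]mv -scalerDl enormZ v1 mulr1 ger0_norm; last first.
  by have := enorm_ge0 m; lra.
by lra.
Qed.

Lemma dist_to_boundary_gt0 Om x : open Om -> bounded_set Om -> Om x ->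
  0 < dist_to x (boundary Om).
Proof.
move=> oOm bOm Ox; have [e e0 eOm] := open_enormP oOm Ox.
apply: (lt_le_trans e0); apply: dist_to_ge => [|y yb].
  by apply: boundary_nonempty => //; exists x.
rewrite leNgt; apply/negP; rewrite enormB => /eOm.
exact: open_boundaryF yb.
Qed.

(** The distance to the boundary is continuous, vanishes on the boundary and is
    positive in the domain. *)
Lemma incentre_exists Om : open Om -> bounded_set Om -> Om !=set0 ->
  exists c, incentre Om c.
Proof.
move=> oOm bOm Om0; have bd0 := boundary_nonempty oOm bOm Om0.
have lip x y : dist_to x (boundary Om) <= dist_to y (boundary Om) + enorm (x - y).
  rewrite -lerBlDr; apply: dist_to_ge => // z zb.
  have := dist_to_le x zb; have := ler_enorm_dist y x z; lra.
have cd : continuous (fun x => dist_to x (boundary Om)).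
  move=> x; have FF := nbhs_filter x; apply/cvgrPdist_lt => e e0.
  apply: filterS (near_enorm_lt x e0) => y; have := lip x y; have := lip y x.
  by rewrite (enormB x y) ltr_norml => h1 h2 h3; apply/andP; split; lra.
have [|c cP cmax] :=
  @EVT_min_closure _ _ Om bOm (fun x => - dist_to x (boundary Om)) Om0.
  by move=> x; apply: cvgN; exact: (continuous_subspaceT cd).
have {}cmax x : Om x -> dist_to x (boundary Om) <= dist_to c (boundary Om).
  by move=> /subset_closure /cmax; rewrite lerN2.
have [Oc|cb] := open_boundary oOm cP.
  exists c; split => //; apply/eqP; rewrite eq_le; apply/andP; split.
    apply: ub_le_sup; last by exists c.
    by exists (dist_to c (boundary Om)) => _ [x Ox <-]; exact: cmax.
  apply: ge_sup; first by exists (dist_to c (boundary Om)), c.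
  by move=> _ [x Ox <-]; exact: cmax.
have [p Op] := Om0; have := dist_to_boundary_gt0 oOm bOm Op.
have := cmax p Op; have := dist_to_le c cb; rewrite subrr enorm0; lra.
Qed.

(** On a segment that leaves an open set, the first point outside the set is a
    boundary point. *)
Lemma ball_subset Om c rho : open Om -> Om c ->
  (forall y, boundary Om y -> rho <= enorm (c - y)) ->
  forall x, enorm (x - c) < rho -> Om x.
Proof.
move=> oOm Oc crho x xc; apply: contrapT => nOx.
pose g (t : R) := c + t *: (x - c).
pose S := [set t : R | 0 <= t /\ ~ Om (g t)].
have S0 : S !=set0 by exists 1; split => //; rewrite /g scale1r addrC subrK.
have lS : has_lbound S by exists 0 => t [].
pose t0 := inf S.
have t01 : t0 <= 1.
  by apply: ge_inf => //; split => //; rewrite /g scale1r addrC subrK.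
have t00 : 0 <= t0 by apply: lb_le_inf => // t [].
have gE s t : enorm (g s - g t) = `|s - t| * enorm (x - c).
  by rewrite /g opprD addrACA subrr add0r -scalerBl enormZ.
have xc0 : 0 < enorm (x - c).
  by rewrite enorm_gt0 subr_eq0; apply/eqP => xc_eq; apply: nOx; rewrite xc_eq.
have before t : 0 <= t -> t < t0 -> Om (g t).
  move=> t_ge0 tt0; apply: contrapT => nOt.
  by have := ge_inf lS (conj t_ge0 nOt); rewrite leNgt tt0.
have nOt0 : ~ Om (g t0).
  move=> Ot0; have [e e0 eOm] := open_enormP oOm Ot0.
  have := inf_adherent (divr_gt0 e0 xc0) (conj S0 lS).
  move=> [t [t_ge0 nOt]]; rewrite -/t0 => tt0.
  have t0t : t0 <= t by exact: (ge_inf lS (conj t_ge0 nOt)).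
  apply: nOt; apply: eOm.
  by rewrite gE ger0_norm ?subr_ge0// -ltr_pdivlMr// ltrBlDl; exact: tt0.
have t0_gt0 : 0 < t0.
  rewrite lt_neqAle t00 andbT; apply/eqP => t0E; apply: nOt0.
  by rewrite -t0E /g scale0r addr0.
suff /crho : boundary Om (g t0).
  rewrite enormB /g addrC addKr enormZ ger0_norm// leNgt.
  by rewrite (le_lt_trans _ xc)// ler_piMl// ltW.
split; last by rewrite (interior_id Om).1.
apply/closure_enormP => e e0.
pose d := Num.min (t0 / 2) (e / (2 * enorm (x - c))).
have d0 : 0 < d by rewrite lt_min !divr_gt0// mulr_gt0.
have dt : d <= t0 / 2 by rewrite ge_min lexx.
exists (g (t0 - d)); first by apply: before; lra.
rewrite gE addrAC subrr add0r normrN gtr0_norm//.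
apply: (@le_lt_trans _ _ (e / (2 * enorm (x - c)) * enorm (x - c))).
  by rewrite ler_pM2r// ge_min lexx orbT.
by rewrite invfM mulrA divfK ?gt_eqF//; lra.
Qed.

Lemma incentre_ball_subset Om c : open Om -> incentre Om c ->
  forall x, enorm (x - c) < inradius Om -> Om x.
Proof.
move=> oOm [Oc <-]; apply: ball_subset => // y.
exact: dist_to_le.
Qed.

End inscribed_balls.

(** * Intrinsic diameter, and the eigenvalues of a ball *)

Section intrinsic_diameter.
Variables (R : realType) (n : nat).
Hypothesis hn : (0 < n)%N.
Implicit Types (x y c : 'rV[R]_n) (Om : set 'rV[R]_n).

Lemma curve_length_ge (g : R -> 'rV[R]_n) :
  ((enorm (g 0 - g 1))%:E <= curve_length g)%E.
Proof.
apply: ereal_sup_ubound; exists [:: 1]; last by rewrite big_ord1 /= enormB.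
by split; rewrite /= ?ltr01.
Qed.

Lemma enorm_le_geodist Om x y : ((enorm (x - y))%:E <= geodist Om x y)%E.
Proof.
apply: le_ereal_inf_tmp => _ [g [_ g0 g1 _] <-].
by rewrite -g0 -g1; exact: curve_length_ge.
Qed.

Lemma enorm_le_intrinsic_diam Om x y : closure Om x -> closure Om y ->
  ((enorm (x - y))%:E <= intrinsic_diam Om)%E.
Proof.
move=> Ox Oy; apply: le_trans (enorm_le_geodist Om x y) _.
by apply: ereal_sup_ubound; exists x, y.
Qed.

(** Along an increasing subdivision, the increments telescope. *)
Lemma sum_increments (a : R) s : path <%O a s ->
  \sum_(i < size s) `|nth 0 s i - nth 0 (a :: s) i| = last a s - a.
Proof.
elim: s a => [a _|b s ih a /= /andP[ab bs]]; first by rewrite big_ord0 subrr.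
rewrite big_ord_recl/= ger0_norm ?subr_ge0 ?(ltW ab)//.
under eq_bigr do rewrite /bump/= add0n.
by rewrite ih//; lra.
Qed.

Lemma geodist_segment_le Om x y :
  (forall t : R, 0 <= t <= 1 -> closure Om (x + t *: (y - x))) ->
  (geodist Om x y <= (enorm (x - y))%:E)%E.
Proof.
move=> xyOm; pose g (t : R) := x + t *: (y - x).
have gE s t : g s - g t = (s - t) *: (y - x).
  by rewrite /g opprD addrACA subrr add0r -scalerBl.
have g_in : [set g : R -> 'rV[R]_n |
    [/\ [lipschitz g t | t in `[0, 1]], g 0 = x, g 1 = y
      & forall t, 0 <= t <= 1 -> closure Om (g t)]] g.
  split; rewrite /g ?scale0r ?addr0//; last by rewrite scale1r addrC subrK.
  exists `|y - x|; split; first exact: num_real.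
  move=> M yM [s t] _ /=; rewrite -/(g s) -/(g t) gE normrZ mulrC.
  by rewrite ler_wpM2r// ltW.
apply: (@le_trans _ _ (curve_length g)); first by apply: ereal_inf_lbound; exists g.
apply: ge_ereal_sup => _ [s [s1 /eqP s2] <-]; rewrite lee_fin.
under eq_bigr do rewrite gE enormZ.
by rewrite -mulr_suml sum_increments// s2 subr0 mul1r enormB.
Qed.

(** The chord from a point [x] of the domain through the incentre to the
    opposite side of the inscribed ball is no longer than the diameter. *)
Lemma incentre_outer_radius Om c (D : R) : open Om -> incentre Om c ->
  0 < inradius Om -> intrinsic_diam Om = D%:E ->
  forall x, Om x -> enorm (x - c) <= D - inradius Om.
Proof.
move=> oOm inc rho0 diamE x Ox; apply/ler_addgt0Pr => e e0.
have [v v1 xv] := polar hn (x - c).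
pose s := Num.max 0 (inradius Om - e).
have s0 : 0 <= s by rewrite le_max lexx.
have srho : s < inradius Om by rewrite gt_max rho0/=; lra.
have se : inradius Om - e <= s by rewrite le_max lexx orbT.
have Oy : Om (c - s *: v).
  apply: (incentre_ball_subset oOm inc).
  by rewrite addrC addKr enormN enormZ v1 mulr1 ger0_norm.
have := enorm_le_intrinsic_diam (subset_closure Ox) (subset_closure Oy).
rewrite diamE lee_fin opprB addrCA [X in _ + X]xv -scalerDl enormZ v1 mulr1.
by rewrite ger0_norm; have := enorm_ge0 (x - c); lra.
Qed.

End intrinsic_diameter.

Section euclidean_ball.
Variables (R : realType) (n : nat) (r : R).
Hypotheses (hn : (0 < n)%N) (r0 : 0 < r).
Implicit Types x : 'rV[R]_n.
Local Notation B := (@eball R n r).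

Lemma open_eball : open B.
Proof.
rewrite openE => x /= xr; apply/near_enormP.
exists (r - enorm x); first by rewrite subr_gt0.
by move=> y yx; have := ler_enormD (y - x) x; rewrite subrK /eball/=; lra.
Qed.

Lemma bounded_eball : bounded_set B.
Proof. by apply/bounded_enormP; exists r => x /ltW. Qed.

Lemma eball0 : B 0.
Proof. by rewrite /eball/= enorm0. Qed.

Lemma closure_eball x : closure B x <-> enorm x <= r.
Proof.
split=> [Bx|xr].
  rewrite -(subr0 x); apply: closure_enorm_le Bx => z /ltW.
  by rewrite subr0.
apply/closure_enormP => e e0.
pose t := Num.min 1 (e / (2 * r)).
have t0 : 0 < t by rewrite lt_min ltr01 divr_gt0// mulr_gt0.
have t1 : t <= 1 by rewrite ge_min lexx.
have te : t * r <= e / 2.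
  apply: (@le_trans _ _ (e / (2 * r) * r)).
    by rewrite ler_pM2r// ge_min lexx orbT.
  by rewrite invfM mulrA divfK ?gt_eqF.
have tx : t * enorm x <= t * r by rewrite ler_pM2l.
exists ((1 - t) *: x).
  rewrite /eball/= enormZ ger0_norm ?subr_ge0//.
  have : t * r > 0 by rewrite mulr_gt0.
  have : (1 - t) * enorm x <= (1 - t) * r by rewrite ler_wpM2l// subr_ge0.
  by lra.
rewrite -[X in _ - X]scale1r -scalerBl enormZ addrAC subrr add0r normrN gtr0_norm//.
lra.
Qed.

Lemma boundary_eball x : boundary B x <-> enorm x = r.
Proof.
rewrite /boundary /= (interior_id B).1; last exact: open_eball.
rewrite /setD/= closure_eball; split=> [[xr /negP]|xr].
  by rewrite -leNgt => rx; apply/eqP; rewrite eq_le xr rx.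
by rewrite xr lexx; split=> //; rewrite /eball/= xr ltxx.
Qed.

Lemma inradius_eball : inradius B = r.
Proof.
have [e e1 _] := polar hn (0 : 'rV[R]_n).
have le_r x : dist_to x (boundary B) <= enorm (x - r *: e).
  by apply: dist_to_le; apply/boundary_eball; rewrite enormZ e1 mulr1 gtr0_norm.
have dist_le x : B x -> dist_to x (boundary B) <= r.
  rewrite /eball/= => xr; have [v v1 xv] := polar hn x.
  have vb : boundary B (r *: v).
    by apply/boundary_eball; rewrite enormZ v1 mulr1 gtr0_norm.
  apply: (le_trans (dist_to_le x vb)).
  rewrite [X in X - _]xv -scalerBl enormZ v1 mulr1 distrC gtr0_norm ?subr_gt0//.
  by have := enorm_ge0 x; lra.
have dist0 : dist_to 0 (boundary B) = r.
  apply/eqP; rewrite eq_le (dist_le 0 eball0)/=; apply: dist_to_ge => [|y].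
    by exists (r *: e); apply/boundary_eball; rewrite enormZ e1 mulr1 gtr0_norm.
  by move=> /boundary_eball <-; rewrite sub0r enormN.
apply/eqP; rewrite eq_le; apply/andP; split.
  apply: ge_sup; first by exists r, 0; [exact: eball0|].
  by move=> _ [x Bx <-]; exact: dist_le.
apply: ub_le_sup; last by exists 0; [exact: eball0|].
by exists r => _ [x Bx <-]; exact: dist_le.
Qed.

Lemma lambdaD_eball : lambdaD B = r^-1.
Proof. by rewrite /lambdaD inradius_eball. Qed.

Lemma intrinsic_diam_eball : intrinsic_diam B = (2 * r)%:E.
Proof.
apply/eqP; rewrite eq_le; apply/andP; split.
  apply: ge_ereal_sup => _ [x [y [/closure_eball xr /closure_eball yr ->]]].
  apply: (@le_trans _ _ (enorm (x - y))%:E).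
    apply: geodist_segment_le => t /andP[t0 t1]; apply/closure_eball.
    have -> : x + t *: (y - x) = (1 - t) *: x + t *: y.
      by rewrite scalerBr scalerBl scale1r addrCA addrC addrAC.
    apply: (le_trans (ler_enormD _ _)).
    rewrite !enormZ !ger0_norm ?subr_ge0//.
    have : (1 - t) * enorm x <= (1 - t) * r by rewrite ler_wpM2l// subr_ge0.
    have : t * enorm y <= t * r by rewrite ler_wpM2l.
    by lra.
  by rewrite lee_fin (le_trans (ler_enormD _ _))// enormN; lra.
have [e e1 _] := polar hn (0 : 'rV[R]_n).
have b (s : R) : `|s| = r -> closure B (s *: e).
  by move=> sr; apply/closure_eball; rewrite enormZ e1 mulr1 sr.
have := enorm_le_intrinsic_diam (b r (gtr0_norm r0)) (b (- r) _).
rewrite normrN gtr0_norm// => /(_ erefl); rewrite -scalerBl enormZ e1 mulr1 opprK.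
by rewrite gtr0_norm ?addr_gt0// mulr2n mulrDl mul1r.
Qed.

Lemma lambdaN_eball : lambdaN B = r^-1.
Proof. by rewrite /lambdaN intrinsic_diam_eball/= invfM mulrA divff ?mul1r. Qed.

End euclidean_ball.

(** * Derivatives along lines *)

Section derivatives_along_lines.
Variables (R : realType) (n : nat).
Implicit Types (phi : 'rV[R]_n -> R) (x p v h : 'rV[R]_n) (U : set 'rV[R]_n).

Lemma is_derive_quotient phi x h l : is_derive x h phi l <->
  t^-1 * (phi (t *: h + x) - phi x) @[t --> 0^'] --> l.
Proof.
split=> [[cv <-]|cv]; first exact: cv.
by apply: DeriveDef; [apply/cvg_ex; exists l|exact: cvg_lim].
Qed.

Lemma is_derive_line phi p v (s l : R) : is_derive (s *: v + p) v phi l ->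
  is_derive s 1 (fun t => phi (t *: v + p)) l.
Proof.
have E : (fun t => t^-1 *: (((fun t => phi (t *: v + p)) \o shift s) (t *: 1) -
      phi (s *: v + p))) =
    (fun t => t^-1 *: ((phi \o shift (s *: v + p)) (t *: v) - phi (s *: v + p))).
  by apply/funext => t /=; rewrite [t *: 1]mulr1 scalerDl addrA.
by move=> [cv <-]; apply: DeriveDef; rewrite /derivable /derive/= E.
Qed.

Lemma mvt_line phi p v (c : R) :
  (forall s : R, `|s| <= `|c| -> derivable phi (s *: v + p) v) ->
  exists2 s : R, `|s| <= `|c| & phi (c *: v + p) - phi p = c * 'D_v phi (s *: v + p).
Proof.
move=> dphi; pose psi (t : R) := phi (t *: v + p).
have dpsi (s : R) : `|s| <= `|c| -> is_derive s 1 psi ('D_v phi (s *: v + p)).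
  by move=> /dphi /derivableP; exact: is_derive_line.
have psi0 : psi 0 = phi p by rewrite /psi scale0r add0r.
have mvt (a b : R) : a <= b -> (forall s : R, a <= s <= b -> `|s| <= `|c|) ->
    exists2 s : R, `|s| <= `|c| & psi b - psi a = 'D_v phi (s *: v + p) * (b - a).
  move=> ab abc.
  have [||s sab ->] := @MVT_segment R psi (fun s => 'D_v phi (s *: v + p)) a b ab.
  - move=> s; rewrite in_itv/= => /andP[/ltW sa /ltW sb].
    by apply: dpsi; apply: abc; rewrite sa sb.
  - apply: derivable_within_continuous => s; rewrite in_itv/= => /abc /dpsi.
    exact: @ex_derive.
  - by exists s => //; apply: abc; move: sab; rewrite in_itv.
have [c0|c0] := leP 0 c.
  have [s /andP[s0 sc]|s sc E] := mvt 0 c c0; first by rewrite !ger0_norm.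
  by exists s => //; rewrite -psi0 -/(psi c) E subr0 mulrC.
have [s /andP[s0 sc]|s sc E] := mvt c 0 (ltW c0).
  by rewrite !ler0_norm ?(ltW c0)// lerN2.
exists s => //; rewrite -psi0 -/(psi c).
by rewrite -[LHS]opprB E sub0r mulrN opprK mulrC.
Qed.

Lemma enorm_le_coord x p : (forall i, `|x 0 i| <= `|p 0 i|) -> enorm x <= enorm p.
Proof.
move=> xp; rewrite -(ler_pXn2r (n := 2)) ?nnegrE ?enorm_ge0// !sqr_enorm.
apply: ler_sum => i _; rewrite -!expr2 -(real_normK (num_real (x 0 i))).
by rewrite -(real_normK (num_real (p 0 i))) lerXn2r ?nnegrE.
Qed.

(** Moving along the coordinate axes one after the other splits an increment
    into partial increments, to which the mean value theorem applies. *)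
Lemma C1_on_is_derive U phi x h : open U -> U x -> C1_on U phi ->
  is_derive x h phi (dot h (grad phi x)).
Proof.
move=> oU Ux C1; apply/is_derive_quotient.
apply/cvgrPdist_le => e e0.
pose H := \sum_i `|h 0 i|.
have H0 : 0 < H + 1 by rewrite ltr_wpDl// sumr_ge0.
pose e' := e / (H + 1).
have e'0 : 0 < e' by rewrite divr_gt0.
have [d d0 dP] : exists2 d, 0 < d & forall y, enorm (y - x) < d ->
    U y /\ forall i, `|partial i phi x - partial i phi y| < e'.
  have FF := nbhs_filter x.
  have nU := open_nbhs_nbhs (conj oU Ux).
  have np : \forall y \near x, forall i, `|partial i phi x - partial i phi y| < e'.
    apply: (@filter_forall _ _ _ (nbhs x) FF) => i.
    by move/cvgrPdist_lt: ((C1 x Ux).2 i).2; exact.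
  by have [d d0 dP] := (near_enormP x _).1 (filterI nU np); exists d.
have h0 : 0 < enorm h + 1 by rewrite ltr_wpDl ?enorm_ge0.
near=> t.
have t0 : t != 0 by near: t; exact: nbhs_dnbhs_neq.
have tlt : `|t| < d / (enorm h + 1).
  near: t; apply: dnbhs0_lt; exact: divr_gt0.
have th : `|t| * enorm h < d.
  apply: le_lt_trans (_ : `|t| * (enorm h + 1) < d); last by rewrite -ltr_pdivlMr.
  by rewrite ler_wpM2l// lerDl.
(* [trunc k] keeps the first [k] coordinates of [h], so that [q k] is the [k]-th
   vertex of the path along the axes. *)
pose trunc k : 'rV[R]_n := \row_i (if (i < k)%N then h 0 i else 0).
pose q k := t *: trunc k + x.
have qS (k : 'I_n) : q k.+1 = (t * h 0 k) *: delta_mx 0 k + q k.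
  rewrite /q addrA; congr (_ + _); apply/rowP => i; rewrite !mxE eqxx/= ltnS.
  have [->|ik] := eqVneq i k; first by rewrite leqnn ltnn/= mulr0 addr0 mulr1.
  by rewrite leq_eqVlt val_eqE (negbTE ik)/= mulr0 add0r.
have near_x (k : 'I_n) (s : R) : `|s| <= `|t * h 0 k| ->
    enorm (s *: delta_mx 0 k + q k - x) < d.
  move=> sk; rewrite addrA addrK; apply: le_lt_trans th.
  rewrite -enormZ; apply: enorm_le_coord => i; rewrite !mxE eqxx/=.
  have [->|ik] := eqVneq i k; first by rewrite ltnn mulr0 addr0 mulr1.
  by rewrite mulr0 add0r; case: ifP => //; rewrite mulr0 normr0.
have step (k : 'I_n) : exists2 y, enorm (y - x) < d &
    phi (q k.+1) - phi (q k) = t * h 0 k * partial k phi y.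
  have [s /near_x sk|s /near_x sk E] :=
    @mvt_line phi (q k) (delta_mx 0 k) (t * h 0 k).
    by have [/C1[_ /(_ k)[]]] := dP _ sk.
  by exists (s *: delta_mx 0 k + q k); rewrite // qS.
have [y yx yE] : exists2 y : 'I_n -> 'rV[R]_n, (forall k, enorm (y k - x) < d) &
    forall k : 'I_n, phi (q k.+1) - phi (q k) = t * h 0 k * partial k phi (y k).
  have [y yP] := choice (fun k =>
    let: ex_intro2 y a b := step k in ex_intro _ y (conj a b)).
  by exists y => k; have [] := yP k.
have -> : phi (t *: h + x) - phi x = \sum_(k < n) (t * h 0 k * partial k phi (y k)).
  have -> : t *: h + x = q n.
    by rewrite /q; congr (t *: _ + _); apply/rowP => i; rewrite !mxE ltn_ord.
  have -> : phi x = phi (q 0%N).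
    rewrite /q (_ : trunc 0%N = 0) ?scaler0 ?add0r//.
    by apply/rowP => i; rewrite !mxE.
  rewrite -(telescope_sumr (fun k => phi (q k)) (leq0n n)) big_mkord.
  exact: eq_bigr.
rewrite mulr_sumr /dot -sumrB.
apply: (@le_trans _ _ (\sum_i `|h 0 i| * e')).
  apply: (le_trans (ler_norm_sum _ _ _)); apply: ler_sum => i _.
  have -> : h 0 i * grad phi x 0 i - t^-1 * (t * h 0 i * partial i phi (y i)) =
      h 0 i * (partial i phi x - partial i phi (y i)).
    by rewrite !mxE; field.
  by rewrite normrM ler_wpM2l// ltW//; exact: (dP _ (yx i)).2.
rewrite -mulr_suml -/H /e' mulrA ler_pdivrMr// mulrC ler_pM2l//.
by rewrite lerDl.
Unshelve. all: by end_near. Qed.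

Lemma near_line x h (P : set 'rV[R]_n) : (\forall y \near x, P y) ->
  \forall t \near (0 : R)^'+, P (t *: h + x).
Proof.
move=> /near_enormP[e e0 eP].
have h0 : 0 < enorm h + 1 by rewrite ltr_wpDl ?enorm_ge0.
near=> t; apply: eP; rewrite addrK enormZ.
have t0 : 0 < t by near: t; exact: nbhs_right_gt.
have te : t < e / (enorm h + 1) by near: t; apply: nbhs_right_lt; exact: divr_gt0.
rewrite gtr0_norm//; rewrite ltr_pdivlMr// in te; apply: le_lt_trans te.
by rewrite ler_pM2l// lerDl.
Unshelve. all: by end_near. Qed.

(** Only one-sided contact is used; applied to [h] and to [- h], it determines
    the derivative. *)
Lemma derive_lower_bound phi x h (l b C : R) : is_derive x h phi l ->
  (\forall t \near 0^'+, phi x + t * b - t ^+ 2 * C <= phi (t *: h + x)) -> b <= l.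
Proof.
move=> /is_derive_quotient /cvg_dnbhs_at_right cl lb.
have cb : (b - t * C) @[t --> 0^'+] --> b.
  apply: cvg_at_right_filter.
  have : (b - t * C) @[t --> 0] --> b - 0 * C.
    by apply: cvgB; [exact: cvg_cst|apply: cvgM; [exact: cvg_id|exact: cvg_cst]].
  by rewrite mul0r subr0.
apply: (ler_cvg_to cb cl); near=> t.
have t0 : 0 < t by near: t; exact: nbhs_right_gt.
have lbt : phi x + t * b - t ^+ 2 * C <= phi (t *: h + x) by near: t.
by rewrite [leRHS]mulrC ler_pdivlMr//; lra.
Unshelve. all: by end_near. Qed.

(** If the derivative [g] were decreasing at [0], then [f] would fall below its
    tangent by the mean value theorem. *)
Lemma second_derive_ge0 (f g : R -> R) (L : R) :
  (\forall t \near (0 : R), is_derive (t : R) (1 : R) f (g t)) ->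
  is_derive (0 : R) 1 g L ->
  (\forall t \near 0^'+, f 0 + t * g 0 <= f t) -> 0 <= L.
Proof.
move=> df [cg <-] fge; rewrite leNgt; apply/negP => L0.
have {}cg : t^-1 * (g t - g 0) @[t --> 0^'+] --> 'D_1 g 0.
  apply: cvg_dnbhs_at_right.
  have -> : (fun t => t^-1 * (g t - g 0)) =
      (fun t => t^-1 *: ((g \o shift 0) (t *: 1) - g 0)).
    by apply/funext => t; rewrite /= [t *: 1]mulr1 addr0.
  exact: cg.
have /nbhs_ballP[e1 /= e10 df1] := df.
have [e2 /= e20 gneg] := cvgr_lt _ cg _ L0.
near (0 : R)^'+ => t.
have t0 : 0 < t by near: t; exact: nbhs_right_gt.
have t1 : t < e1 by near: t; exact: nbhs_right_lt.
have t2 : t < e2 by near: t; exact: nbhs_right_lt.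
have ft : f 0 + t * g 0 <= f t by near: t.
have dft (s : R) : 0 <= s -> s <= t -> is_derive s 1 f (g s).
  move=> s0 st; apply: df1; rewrite /ball/= sub0r normrN ger0_norm//.
  exact: le_lt_trans t1.
have [||s] := @MVT R f g 0 t t0.
- by move=> s; rewrite in_itv/= => /andP[/ltW ? /ltW ?]; exact: dft.
- apply: derivable_within_continuous => s; rewrite in_itv/= => /andP[s0 st].
  exact: (@ex_derive _ _ _ _ _ _ _ (dft s s0 st)).
rewrite in_itv/= subr0 => /andP[s0 st] E.
have : s^-1 * (g s - g 0) < 0.
  apply: gneg => //=; rewrite sub0r normrN gtr0_norm//; exact: lt_trans t2.
rewrite pmulr_rlt0 ?invr_gt0// subr_lt0 => gs.
have : g s * t < g 0 * t by rewrite ltr_pM2r.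
by lra.
Unshelve. all: by end_near. Qed.

Lemma dot_grad_hessian phi x e : dot e (\row_i dot e (grad (partial i phi) x)) =
  (e *m hessian phi x *m e^T) 0 0.
Proof.
rewrite !mxE.
rewrite [RHS](eq_bigr (fun j => \sum_i e 0 i * hessian phi x i j * e 0 j)); last first.
  by move=> j _; rewrite !mxE mulr_suml.
rewrite exchange_big; apply: eq_bigr => i _; rewrite !mxE mulr_sumr.
by apply: eq_bigr => j _; rewrite !mxE; ring.
Qed.

Lemma is_derive_ray2 U phi x e : open U -> U x -> C2_on U phi ->
  (\forall t \near (0 : R), is_derive (t : R) (1 : R) (fun t => phi (t *: e + x))
    (dot e (grad phi (t *: e + x)))) /\
  is_derive (0 : R) 1 (fun t : R => dot e (grad phi (t *: e + x)))
    ((e *m hessian phi x *m e^T) 0 0).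
Proof.
move=> oU Ux [C1 C2]; split.
  have [d d0 dU] := open_enormP oU Ux.
  have e0 : 0 < enorm e + 1 by rewrite ltr_wpDl ?enorm_ge0.
  apply: filterS (@nbhs0_lt R R^o _ (divr_gt0 d0 e0)) => t.
  rewrite ltr_pdivlMr// => te.
  apply: is_derive_line; apply: C1_on_is_derive C1 => //.
  apply: dU; rewrite addrK enormZ; apply: le_lt_trans te.
  by rewrite ler_wpM2l// lerDl.
rewrite -dot_grad_hessian /dot.
have dgi i : is_derive (0 : R) 1 (fun t : R => partial i phi (t *: e + x))
    (dot e (grad (partial i phi) x)).
  by apply: is_derive_line; rewrite scale0r add0r; exact: C1_on_is_derive (C2 i).
have -> : (fun t => \sum_i e 0 i * grad phi (t *: e + x) 0 i) =
    \sum_i (e 0 i \*: (fun t => partial i phi (t *: e + x))).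
  by apply/funext => t; rewrite fct_sumE; apply: eq_bigr => i _; rewrite mxE.
have dZ i := is_deriveZ (e 0 i) (dgi i).
apply: (is_derive_eq (is_derive_sum dZ)).
by apply: eq_bigr => i _; rewrite mxE.
Qed.

(** The second-order condition at a contact point with a function that is
    affine along a ray. *)
Lemma ray_contact_hessian_ge0 U phi x e : open U -> U x -> C2_on U phi ->
  (\forall t \near 0^'+, phi x + t * dot e (grad phi x) <= phi (t *: e + x)) ->
  0 <= (e *m hessian phi x *m e^T) 0 0.
Proof.
move=> oU Ux C2 phige; have [df dg] := is_derive_ray2 e oU Ux C2.
apply: second_derive_ge0 df dg _.
by apply: filterS phige => t; rewrite scale0r add0r.
Qed.

Lemma ray_contact_hessian_le0 U phi x e : open U -> U x -> C2_on U phi ->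
  (\forall t \near 0^'+, phi (t *: e + x) <= phi x + t * dot e (grad phi x)) ->
  (e *m hessian phi x *m e^T) 0 0 <= 0.
Proof.
move=> oU Ux C2 phile; have [df dg] := is_derive_ray2 e oU Ux C2.
rewrite -oppr_ge0.
have dgN := is_deriveN dg.
apply: (second_derive_ge0 _ dgN).
  by apply: filterS df => t dft; exact: (is_deriveN dft).
apply: filterS phile => t; rewrite /GRing.opp/= scale0r add0r => h.
by lra.
Qed.

End derivatives_along_lines.

(** * The cone is a ground state of the ball *)

Section cone_ground_state.
Variables (R : realType) (n : nat) (r : R).
Hypotheses (hn : (0 < n)%N) (r0 : 0 < r).
Implicit Types (x h : 'rV[R]_n) (phi : 'rV[R]_n -> R).
Local Notation v := (@v_infty R n r).
Local Notation B := (@eball R n r).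

Lemma cone_line_le (x h : 'rV[R]_n) (e : 'rV[R]_n) (d t : R) : enorm e = 1 ->
  x = d *: e -> 0 <= d -> v (t *: h + x) <= 1 - d / r + t * - (dot e h / r).
Proof.
move=> e1 -> d0; rewrite /v_infty.
have := cauchy_schwarz e (t *: h + d *: e).
rewrite e1 mul1r dotDr !dotZr -[dot e e]sqr_enorm e1 expr1n mulr1 => le_norm.
rewrite mulrN mulrA -addrA -opprD -mulrDl lerD2l lerN2.
by rewrite ler_pM2r ?invr_gt0// addrC.
Qed.

Lemma cone_line_ge (x h : 'rV[R]_n) (e : 'rV[R]_n) (d : R) : enorm e = 1 ->
  x = d *: e -> 0 < d -> \forall t \near 0^'+,
  1 - d / r + t * - (dot e h / r) - t ^+ 2 * (dot h h / (d * r)) <= v (t *: h + x).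
Proof.
move=> e1 -> d0.
have := @near_line R n 0 h _ (near_enorm_lt 0 (divr_gt0 d0 (ltr0n R 2))).
apply: filterS => t; rewrite addr0 subr0 => th.
rewrite /v_infty [t *: h + _]addrC; have := enorm_radial_le d0 e1 th.
rewrite !(dotZl, dotZr) => le_norm.
have {}le_norm : enorm (d *: e + t *: h) <= d + t * dot e h + t ^+ 2 * dot h h / d.
  apply: (le_trans le_norm); rewrite lerD2l ler_pM2r ?invr_gt0//.
  by have := sqr_ge0 (t * dot e h); lra.
have -> : 1 - d / r + t * - (dot e h / r) - t ^+ 2 * (dot h h / (d * r)) =
    1 - (d + t * dot e h + t ^+ 2 * dot h h / d) / r.
  by field; rewrite !gt_eqF.
by rewrite lerD2l lerN2 ler_pM2r ?invr_gt0.
Qed.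

Lemma cone_origin_line (h : 'rV[R]_n) (t : R) : 0 <= t ->
  v (t *: h + 0) = 1 + t * - (enorm h / r).
Proof.
by move=> t0; rewrite /v_infty addr0 enormZ ger0_norm// mulrN mulrA.
Qed.

Lemma cone_origin : v 0 = 1.
Proof. by rewrite /v_infty enorm0 mul0r subr0. Qed.

Lemma eq_of_dot_ge (x y : 'rV[R]_n) : (forall h, dot h y <= dot h x) -> x = y.
Proof.
move=> yx; apply/eqP; rewrite -subr_eq0 -enorm_eq0 -sqrf_eq0 eq_le sqr_ge0 andbT.
rewrite sqr_enorm dotDr dotNr subr_le0.
by have := yx (- (x - y)); rewrite !dotNl lerN2.
Qed.

Section contact_off_centre.
Variables (U : set 'rV[R]_n) (phi : 'rV[R]_n -> R) (x e : 'rV[R]_n) (d : R).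
Hypotheses (oU : open U) (Ux : U x) (C2 : C2_on U phi).
Hypotheses (e1 : enorm e = 1) (xE : x = d *: e) (d0 : 0 < d) (phix : phi x = v x).

Let vx : v x = 1 - d / r.
Proof. by rewrite /v_infty xE enormZ e1 mulr1 gtr0_norm. Qed.

Let ee : dot e e = 1.
Proof. by rewrite -sqr_enorm e1 expr1n. Qed.

Let dphi h : is_derive x h phi (dot h (grad phi x)).
Proof. exact: C1_on_is_derive C2.1. Qed.

Let laplacianE : grad phi x = - r^-1 *: e ->
  infty_laplacian phi x = r^-1 ^+ 2 * (e *m hessian phi x *m e^T) 0 0.
Proof.
move=> gE; rewrite /infty_laplacian gE linearZ/= -!scalemxAl -scalemxAr scalerA.
by rewrite mxE; congr (_ * _); rewrite mulrNN expr2.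
Qed.

(** Contact forces the gradient of [phi] to be that of the cone, hence radial.
    The infinity-Laplacian is then a multiple of the second derivative along the
    ray, on which the cone is affine. *)
Lemma cone_contact_above : (\forall y \near x, v y <= phi y) ->
  0 <= infty_laplacian phi x.
Proof.
move=> vphi.
have gE : grad phi x = - r^-1 *: e.
  apply: eq_of_dot_ge => h.
  apply: (@derive_lower_bound _ _ _ _ _ _ _ (dot h h / (d * r)) (dphi h)).
  have := cone_line_ge h e1 xE d0; apply: filterS2 (near_line h vphi) => t le1 le2.
  rewrite phix vx dotZr dotC mulNr [r^-1 * _]mulrC; exact: le_trans le1.
rewrite laplacianE// mulr_ge0 ?sqr_ge0//; apply: (ray_contact_hessian_ge0 oU Ux C2).
have near_d : \forall t \near (0 : R)^'+, t < d by exact: nbhs_right_lt.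
have near_0 : \forall t \near (0 : R)^'+, 0 < t by exact: nbhs_right_gt.
apply: filterS2 (near_line e vphi) (filterI near_0 near_d) => t le1 [t0 td].
apply: le_trans le1; rewrite gE dotZr ee mulr1 phix vx xE -scalerDl /v_infty.
by rewrite enormZ e1 mulr1 gtr0_norm ?addr_gt0// mulrDl; lra.
Qed.

Lemma cone_contact_below : (\forall y \near x, phi y <= v y) ->
  grad phi x = - r^-1 *: e /\ infty_laplacian phi x <= 0.
Proof.
move=> phiv.
have gE : grad phi x = - r^-1 *: e.
  apply/esym/eq_of_dot_ge => h.
  rewrite -lerN2; have dN : is_derive x h (- phi) (- dot h (grad phi x)).
    exact: is_deriveN.
  apply: (@derive_lower_bound _ _ _ _ _ _ _ 0 dN).
  apply: filterS (near_line h phiv) => t le1.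
  have := cone_line_le h t e1 xE (ltW d0).
  rewrite mulr0 subr0 /= !fctE phix vx dotZr dotC mulNr opprK.
  rewrite [r^-1 * _]mulrC mulrN => le2.
  by have := le_trans le1 le2; lra.
split=> //.
rewrite laplacianE// mulr_ge0_le0 ?sqr_ge0//.
apply: (ray_contact_hessian_le0 oU Ux C2).
have := nbhs_right_gt (0 : R).
apply: filterS2 (near_line e phiv) => t le1 t0.
apply: (le_trans le1); rewrite gE dotZr ee mulr1 phix vx xE -scalerDl /v_infty.
by rewrite enormZ e1 mulr1 gtr0_norm ?addr_gt0// mulrDl; lra.
Qed.

End contact_off_centre.

Lemma continuous_v_infty : continuous v.
Proof.
move=> x; have FF := nbhs_filter x; rewrite /v_infty.
apply: cvgB; first exact: cvg_cst.
apply: cvgM; last exact: cvg_cst.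
have := @continuous_enormB R n 0 x.
rewrite (_ : (fun x => enorm (x - 0)) = @enorm R n)//.
by apply/funext => y; rewrite subr0.
Qed.

(** At the vertex, the inequality between the gradient and the eigenvalue term
    holds: a smooth function above the cone has slope at most [r^-1] there. *)
Lemma v_infty_subsolution : viscosity_subsolution r^-1 B v.
Proof.
move=> x U phi Bx oU Ux C2 phix vphi; rewrite /eigen_operator ge_min.
have [x0|x0] := eqVneq x 0; last first.
  have [e e1 xE] := polar hn x; apply/orP; left; rewrite oppr_le0.
  by apply: (cone_contact_above oU Ux C2 e1 xE _ phix vphi); rewrite enorm_gt0.
apply/orP; right; rewrite x0 cone_origin mulr1 subr_le0.
have Cp h : is_derive x h phi (dot h (grad phi x)) by exact: C1_on_is_derive C2.1.
rewrite x0 in phix vphi Cp *; set p := grad phi 0 in Cp *.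
have [->|p0] := eqVneq p 0; first by rewrite enorm0 invr_ge0 ltW.
have : - (enorm p / r) <= dot (- p) p.
  apply: (@derive_lower_bound _ _ _ _ _ _ _ 0 (Cp (- p))).
  apply: filterS2 (near_line (- p) vphi) (nbhs_right_gt 0) => t le1 t0.
  by rewrite mulr0 subr0 phix cone_origin -(enormN p) -cone_origin_line// ltW.
rewrite dotNl lerN2 -sqr_enorm expr2 ler_pM2l ?enorm_gt0//.
Qed.

Lemma v_infty_supersolution : viscosity_supersolution r^-1 B v.
Proof.
move=> x U phi Bx oU Ux C2 phix phiv; rewrite /eigen_operator le_min.
have [e e1 xE] := polar hn x.
have [x0|x0] := eqVneq x 0; last first.
  have d0 : 0 < enorm x by rewrite enorm_gt0.
  have [gE lap] := cone_contact_below oU Ux C2 e1 xE d0 phix phiv.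
  rewrite oppr_ge0 lap /= gE enormZ e1 mulr1 normrN gtr0_norm ?invr_gt0//.
  rewrite subr_ge0 ger_pMr ?invr_gt0// /v_infty.
  by rewrite gerBl divr_ge0 ?enorm_ge0// ltW.
(* At the vertex, the slopes in the directions [e] and [- e] would both be
   negative, so no differentiable function touches the cone from below. *)
exfalso; rewrite x0 in phix phiv Ux.
have slope h : dot h (grad phi 0) <= - (enorm h / r).
  have dN : is_derive 0 h (- phi) (- dot h (grad phi 0)).
    by apply: is_deriveN; exact: C1_on_is_derive C2.1.
  rewrite -lerN2 opprK; apply: (@derive_lower_bound _ _ _ _ _ _ _ 0 dN).
  apply: filterS2 (near_line h phiv) (nbhs_right_gt 0) => t le1 t0.
  rewrite (cone_origin_line h (ltW t0)) in le1.
  rewrite /GRing.opp/= phix cone_origin mulr0 subr0; lra.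
have := slope e; have := slope (- e); rewrite enormN e1 dotNl.
have : 0 < 1 / r by rewrite divr_gt0.
by lra.
Qed.

Lemma v_infty_ground_state : lebesgueRn B != 0%E -> normalized_ground_state B v.
Proof.
move=> B0; split; last first.
  rewrite (@Linfty_norm_max _ _ B v 0 hn)//.
  - by rewrite cone_origin normr1.
  - exact: open_eball.
  - exact: bounded_eball.
  - exact: eball0.
  - exact: continuous_v_infty.
  - move=> x Bx; have vx1 : v x <= 1.
      by rewrite /v_infty gerBl divr_ge0 ?enorm_ge0// ltW.
    have vx0 : 0 <= v x by rewrite /v_infty subr_ge0 ler_pdivrMr// mul1r ltW.
    by rewrite cone_origin normr1 ger0_norm.
rewrite /infty_ground_state lambdaD_eball//; split.
- exact: continuous_subspaceT continuous_v_infty.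
- exact: v_infty_subsolution.
- exact: v_infty_supersolution.
- move=> x /(boundary_eball r0); rewrite /v_infty => ->.
  by rewrite divff ?subrr// gt_eqF.
- by exists 0; split; [exact: eball0|rewrite cone_origin oner_neq0].
Qed.

End cone_ground_state.

(** * Stability *)

Section stability.
Variables (R : realType) (n : nat) (r : R).
Hypotheses (hn : (0 < n)%N) (r0 : 0 < r).

(** The domain lies in the ball of radius [2 / lambdaN Om - 1 / lambdaD Om]
    about an incentre, and [2 * (lambdaD Om / lambdaN Om) - 2] is the resulting
    distance to the cone of slope [lambdaD Om]; the other term comes from
    changing the slope to [r^-1]. *)
Lemma ground_state_close_to_v_infty (Om : set 'rV[R]_n) (u : 'rV[R]_n -> R) c x :
  open Om -> bounded_set Om -> normalized_ground_state Om u ->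
  incentre Om c -> 0 < lambdaD Om -> 0 < lambdaN Om ->
  eball r x -> lambdaD Om * enorm x < 1 ->
  `|zero_extension Om u (c + x) - v_infty r x| <=
    2 * (lambdaD Om / lambdaN Om) - 2 + r * `|lambdaD Om - r^-1|.
Proof.
move=> oOm bOm ngs inc lamD0 lamN0 xr x1.
have rad0 : 0 < inradius Om by rewrite -invr_gt0.
have Ocx : Om (c + x).
  apply: (incentre_ball_subset oOm inc); rewrite addrC addKr.
  rewrite -[inradius Om]invrK -[X in X^-1]/(lambdaD Om).
  by rewrite -[X in _ < X]mul1r ltr_pdivlMr// mulrC.
have diamE : intrinsic_diam Om = (2 / lambdaN Om)%:E.
  move: lamN0; rewrite /lambdaN; case: (intrinsic_diam Om) => [d| |] /=.
  - by move=> _; rewrite invfM invrK mulrA divff ?mul1r.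
  - by rewrite invr0 mulr0 ltxx.
  - by rewrite invr0 mulr0 ltxx.
have outer := incentre_outer_radius hn oOm inc rad0 diamE.
have := ground_state_close_to_cone hn oOm bOm ngs lamD0 outer Ocx.
have -> : zero_extension Om u (c + x) = u (c + x).
  by rewrite /zero_extension patchE mem_set.
have -> : (2 / lambdaN Om - inradius Om) * lambdaD Om - 1 =
    2 * (lambdaD Om / lambdaN Om) - 2.
  by rewrite /lambdaD in lamD0 *; field; rewrite !gt_eqF.
have -> : c + x - c = x by rewrite addrC addKr.
move=> close_u.
rewrite -(subrK (1 - lambdaD Om * enorm x) (u _)) -addrA.
apply: (le_trans (ler_normD _ _)); apply: lerD close_u _.
have -> : 1 - lambdaD Om * enorm x - v_infty r x = - (lambdaD Om - r^-1) * enorm x.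
  by rewrite /v_infty; lra.
by rewrite normrM normrN mulrC (ger0_norm (enorm_ge0 _)) ler_wpM2r// ltW.
Qed.

End stability.

Theorem corollary1p4 (R : realType) (n : nat) (hn : (0 < n)%N) (r : R)
    (hr : 0 < r) (Om : nat -> set 'rV[R]_n) (u : nat -> 'rV[R]_n -> R)
    (hOm : forall k, bounded_domain (Om k))
    (hvol : forall k, lebesgueRn (Om k) = lebesgueRn (@eball R n r))
    (hu : forall k, normalized_ground_state (Om k) (u k))
    (hD : `|lambdaD (Om k) - lambdaD (@eball R n r)| @[k --> \oo] --> 0)
    (hN : `|lambdaN (Om k) - lambdaN (@eball R n r)| @[k --> \oo] --> 0) :
  [/\ normalized_ground_state (@eball R n r) (@v_infty R n r),
      forall w, normalized_ground_state (@eball R n r) w ->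
        forall x, eball r x -> w x = v_infty r x,
      forall k, exists c, incentre (Om k) c
    & forall c : nat -> 'rV[R]_n, (forall k, incentre (Om k) (c k)) ->
        locally_uniformly (@eball R n r)
          (fun k x => zero_extension (Om k) (u k) (c k + x)) (@v_infty R n r)].
Proof.
have oB := @open_eball R n r; have bB := @bounded_eball R n r.
split.
- apply: v_infty_ground_state => //; rewrite -(hvol 0%N); apply/eqP.
  by move=> /(Linfty_norm_null (u 0%N)); rewrite (hu 0%N).2.
- move=> w hw x Bx; apply/eqP; rewrite -subr_eq0 -normr_le0.
  have := @ground_state_close_to_cone R n (eball r) w hn oB bB 0 r hw.
  rewrite lambdaD_eball// invr_gt0 => /(_ hr) h.
  rewrite (le_trans _ (le_trans (h _ x Bx) _))//.
  + by rewrite subr0 /v_infty mulrC.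
  + by move=> y By; rewrite subr0 ltW.
  + by rewrite divff ?subrr// gt_eqF.
- move=> k; have [oOm _ bOm] := hOm k; apply: incentre_exists => //.
  by have [[_ _ _ _ [x [Ox _]]] _] := hu k; exists x.
move=> c hc x Bx.
have ri0 : 0 < r^-1 by rewrite invr_gt0.
have cD : lambdaD (Om k) @[k --> \oo] --> r^-1.
  rewrite (lambdaD_eball hn hr) in hD.
  by apply/subr_cvg0; exact: norm_cvg0 hD.
have cN : lambdaN (Om k) @[k --> \oo] --> r^-1.
  rewrite (lambdaN_eball hn hr) in hN.
  by apply/subr_cvg0; exact: norm_cvg0 hN.
(* A radius strictly between those of [x] and of the ball. *)
pose s := (enorm x + r) / 2.
have xs : enorm x < s by move: Bx; rewrite /eball/= /s; lra.
have sr : s < r by move: Bx; rewrite /eball/= /s; lra.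
have s0 : 0 < s := le_lt_trans (enorm_ge0 x) xs.
exists (eball s); first by apply: open_nbhs_nbhs; split => //; exact: open_eball.
have rate : 2 * (lambdaD (Om k) / lambdaN (Om k)) - 2 +
    r * `|lambdaD (Om k) - r^-1| @[k --> \oo] --> 0.
  have -> : 0 = 2 * (r^-1 / r^-1) - 2 + r * `|r^-1 - r^-1| :> R.
    by rewrite divff ?gt_eqF// subrr normr0 mulr0 mulr1 subrr addr0.
  apply: cvgD.
    apply: cvgB; last exact: cvg_cst.
    apply: cvgM; first exact: cvg_cst.
    by apply: cvgM => //; apply: cvgV => //; rewrite gt_eqF.
  apply: cvgM; first exact: cvg_cst.
  by apply: cvg_norm; apply: cvgB => //; exact: cvg_cst.
move=> P /uniform_nbhs[E [entE EP]].
have [e /= e0 eE] : exists2 e : R, 0 < e & forall a b : R, `|a - b| < e -> E (a, b).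
  move: entE; rewrite -entourage_ballE => -[e /= e0 eE].
  by exists e => // a b ab; apply: eE; rewrite /= -ball_normE.
near=> k; apply: EP => y ys; apply: eE; rewrite distrC.
have [oOm _ bOm] := hOm k.
have lamD0 : 0 < lambdaD (Om k).
  by near: k; exact: cvgr_gt cD _ ri0.
have lamN0 : 0 < lambdaN (Om k).
  by near: k; exact: cvgr_gt cN _ ri0.
have lams : lambdaD (Om k) < s^-1.
  by near: k; apply: cvgr_lt cD _ _; rewrite ltf_pV2.
have rk : 2 * (lambdaD (Om k) / lambdaN (Om k)) - 2 +
    r * `|lambdaD (Om k) - r^-1| < e.
  by near: k; exact: cvgr_lt rate _ e0.
apply: le_lt_trans rk; apply: ground_state_close_to_v_infty => //.
  exact: (lt_trans ys sr).
apply: (@lt_trans _ _ (lambdaD (Om k) * s)); first by rewrite ltr_pM2l.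
by rewrite -ltr_pdivlMr// mul1r.
Unshelve. all: by end_near. Qed.
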